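(* Let $G$ be a simple graph of order $n\ge 3$ with $m$ edges such that $G$ is not isomorphic to $(K_1\cup K_{n-r-1})\vee K_r$ for any $r$ with $0\le r\le\lceil n/2\rceil-2$ or $r=n-2$. Then $\mu_{n-2}(G)\le\frac{2m}{n}+1$, with equality if and only if $G\cong K_n$, or $n$ is even and $G\cong 2K_{n/2}$, or $n$ is even and $G\cong (K_1\cup K_{n/2})\vee K_{n/2-1}$.
   Context: The Laplacian matrix of $G$ is $L(G)=D(G)-A(G)$ ($D(G)$ diagonal degree matrix, $A(G)$ adjacency matrix), with eigenvalues $\mu_1(G)\ge\mu_2(G)\ge\cdots\ge\mu_n(G)=0$. $K_p$ is the complete graph, $\cup$ denotes vertex-disjoint union, $2K_{p}$ two disjoint copies of $K_p$, and $G_1\vee G_2$ is the join (disjoint union plus all edges between $V(G_1)$ and $V(G_2)$); $K_0$ is the empty graph. *)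

(* Defs.v *)
From mathcomp Require Import all_boot all_order all_algebra.
From mathcomp Require Import polyrcf.

Set Implicit Arguments.
Unset Strict Implicit.
Unset Printing Implicit Defensive.
Import Order.TTheory GRing.Theory Num.Theory.
Local Open Scope ring_scope.

Record sgraph := SGraph {
  vertex :> finType;
  adj : rel vertex;
  adj_sym : symmetric adj;
  adj_irr : irreflexive adj
}.

Definition edges (G : sgraph) : {set {set G}} :=
  [set [set p.1; p.2] | p in [pred p : G * G | adj p.1 p.2]].

Definition degree (G : sgraph) (x : G) : nat := #|[set y | adj x y]|.

Definition iso_graph (G H : sgraph) : Prop :=
  exists2 f : G -> H, bijective f & {mono f : x y / adj x y}.

Section Complete.
Variable p : nat.
Let rel_complete : rel 'I_p := fun i j => i != j.
Fact rel_complete_sym : symmetric rel_complete.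
Proof. by move=> i j; rewrite /rel_complete eq_sym. Qed.
Fact rel_complete_irr : irreflexive rel_complete.
Proof. by move=> i; rewrite /rel_complete eqxx. Qed.
Definition complete : sgraph := SGraph rel_complete_sym rel_complete_irr.
End Complete.

Section UnionJoin.
Variables G H : sgraph.

(* [b] tells whether vertices from different sides are adjacent. *)
Let rel_sum (b : bool) : rel (G + H)%type := fun x y =>
  match x, y with
  | inl u, inl v => adj u v
  | inr u, inr v => adj u v
  | _, _ => b
  end.
Fact rel_sum_sym b : symmetric (rel_sum b).
Proof. by move=> [u|u] [v|v] //=; rewrite adj_sym. Qed.
Fact rel_sum_irr b : irreflexive (rel_sum b).
Proof. by move=> [u|u] /=; rewrite adj_irr. Qed.

Definition disj_union : sgraph := SGraph (rel_sum_sym false) (rel_sum_irr false).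
Definition join : sgraph := SGraph (rel_sum_sym true) (rel_sum_irr true).
End UnionJoin.

Section Laplacian.
Variables (R : rcfType) (G : sgraph).

(* Rows and columns follow the enumeration of the vertices. *)
Definition degree_mx : 'M[R]_#|G| :=
  diag_mx (\row_i (degree (enum_val i : G))%:R).
Definition adjacency_mx : 'M[R]_#|G| :=
  \matrix_(i, j) (adj (enum_val i : G) (enum_val j))%:R.
Definition laplacian_mx : 'M[R]_#|G| := degree_mx - adjacency_mx.
End Laplacian.

(* The roots in [R] of the characteristic polynomial, each repeated according
   to its multiplicity, in nonincreasing order.  Only the eigenvalues lying in
   [R] are listed; for a symmetric [A] these are all of them, so that the list
   has size [n]. *)
Definition eigenvalues (R : rcfType) (n : nat) (A : 'M[R]_n) : seq R :=
  sort (fun x y => y <= x)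
    (flatten [seq nseq (mup x (char_poly A)) x | x <- rootsR (char_poly A)]).

(* The index starts at 1: [lap_mu R G 1] is the largest eigenvalue. *)
Definition lap_mu (R : rcfType) (G : sgraph) (i : nat) : R :=
  (eigenvalues (laplacian_mx R G))`_i.-1.

(* Main.v *)
Require Import Defs.
From mathcomp Require Import all_boot all_order all_algebra.
From mathcomp Require Import polyrcf complex.
From mathcomp Require Import zify ring lra.
Import Order.TTheory GRing.Theory Num.Theory.
Local Open Scope ring_scope.

Set Implicit Arguments.
Unset Strict Implicit.
Unset Printing Implicit Defensive.

(* Let H be the complement of G and d the average degree of H.  Since
   L(G) + L(H) = n I - J, the claim reads mu_2(H) >= d, and mu_2(H) > d follows
   from a two-dimensional space of vectors whose Rayleigh quotient for L(H)
   exceeds d.  Such a space is spanned by vectors supported on two vertices u, v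
   and on their neighbourhoods, where u has maximal degree and v has maximal
   degree k among the other vertices; only the edges at u and v are counted.

   If deg u <= d, then H is regular, and a triangle or two nonadjacent vertices
   with distinct neighbourhoods give the space; otherwise H is empty or
   K_{n/2,n/2}.  If deg u > d and k <= 1, an edge avoiding u gives the space, and
   otherwise H is a star with isolated vertices.  If k >= 2 and k > d, symmetric
   and antisymmetric combinations of the stars at u and v suffice.  If
   2 <= k <= d < deg u, one combines e_u with a weighted star at v; that the
   resulting form is positive follows by counting the edges between the
   neighbours and the nonneighbours of u. *)

(** * Eigenvalues of symmetric matrices *)

Definition qform (R : rcfType) n (A : 'M[R]_n) (v : 'rV[R]_n) : R :=
  (v *m A *m v^T) 0 0.

Lemma qform1E (R : rcfType) n (v : 'rV[R]_n) :
  qform 1%:M v = \sum_i v 0 i ^+ 2.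
Proof. by rewrite /qform mulmx1 mxE; apply: eq_bigr => i _; rewrite mxE. Qed.

Section Spectral.
Variable R : rcfType.
Local Open Scope sesquilinear_scope.
Local Open Scope complex_scope.
Local Notation C := R[i].
Local Notation toC := (map_mx (real_complex R)).

Lemma char_poly_conj (F : fieldType) n (P B : 'M[F]_n) : P \in unitmx ->
  char_poly (invmx P *m B *m P) = char_poly B.
Proof.
move=> uP; rewrite /char_poly.
have e1 : map_mx polyC (invmx P) *m map_mx polyC P = 1%:M.
  by rewrite -map_mxM mulVmx // map_mx1.
have eC : char_poly_mx (invmx P *m B *m P) =
    map_mx polyC (invmx P) *m char_poly_mx B *m map_mx polyC P.
  rewrite /char_poly_mx mulmxBr mulmxBl !map_mxM mul_mx_scalar -scalemxAl e1.
  by rewrite scalemx1.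
by rewrite eC !det_mulmx mulrAC -det_mulmx e1 det1 mul1r.
Qed.

(** The change of basis is complex while [l] is real: the spectral theorem is applied over [R[i]],
    and only the eigenvalues have to come back to [R]. *)
Definition diagonalizes n (A : 'M[R]_n) (P : 'M[C]_n) (l : 'rV[R]_n) :=
  P \is unitarymx /\ toC A = P^t* *m diag_mx (toC l) *m P.

Lemma symmetric_diagonalizable n (A : 'M[R]_n) : A^T = A ->
  {P : 'M[C]_n & {l : 'rV[R]_n | diagonalizes A P l}}.
Proof.
move=> symA.
have hA : toC A \is hermsymmx.
  apply/is_hermitianmxP; rewrite expr0 scale1r -{1}symA.
  by apply/matrixP => i j; rewrite !mxE; apply/esym/conjc_real.
have nA := hermitian_normalmx hA.
have rl := hermitian_spectral_diag_real hA.
exists (spectralmx (toC A)), (map_mx (@complex.Re R) (spectral_diag (toC A))).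
split; first exact: spectral_unitarymx.
rewrite -invmx_unitary ?spectral_unitarymx //.
have -> : toC (map_mx (@complex.Re R) (spectral_diag (toC A))) = spectral_diag (toC A).
  by apply/matrixP => i j; rewrite !mxE; apply: RRe_real; apply: (mxOverP rl).
exact: (orthomx_spectralP nA).
Qed.

Lemma diagonalizesN n (A : 'M[R]_n) P l :
  diagonalizes A P l -> diagonalizes (- A) P (- l).
Proof.
case=> uP eA; split=> //; rewrite !map_mxN eA /= -mulNmx -mulmxN.
by congr (_ *m _ *m _); apply/matrixP => i j; rewrite !mxE mulNrn.
Qed.

Lemma char_poly_diagonalizes n (A : 'M[R]_n) P l : diagonalizes A P l ->
  char_poly A = \prod_i ('X - (l 0 i)%:P).
Proof.
case=> uP eA; apply: (@map_poly_inj _ _ (real_complex R)).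
rewrite map_char_poly eA -invmx_unitary // char_poly_conj ?unitarymx_unit //.
rewrite char_poly_trig; last first.
  by apply/is_trig_mxP => i j ltij; rewrite !mxE -val_eqE /= (ltn_eqF ltij).
rewrite rmorph_prod; apply: eq_bigr => i _.
by rewrite rmorphB /= map_polyX map_polyC !mxE eqxx.
Qed.

(** Both lists contain each [x] as often as its multiplicity as a root of the characteristic
    polynomial, which splits over [R]. *)
Lemma eigenvalues_perm n (A : 'M[R]_n) P l : diagonalizes A P l ->
  perm_eq (eigenvalues A) [seq l 0 i | i : 'I_n].
Proof.
move=> dA; rewrite /eigenvalues (permPl (permEl (perm_sort _ _))).
have eA : char_poly A = \prod_(x <- [seq l 0 i | i : 'I_n]) ('X - x%:P).
  by rewrite big_image (char_poly_diagonalizes dA).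
set p := char_poly A in eA *; set t := [seq _ | _ : _] in eA *.
have p0 : p != 0 by rewrite monic_neq0 ?char_poly_monic.
apply/allP => x _; apply/eqP => /=.
have -> : count_mem x t = mup x p by rewrite eA mu_prod_XsubC.
rewrite count_flatten -map_comp sumnE big_map.
have cE y : (count_mem x \o (fun x0 => nseq (mup x0 p) x0)) y
   = if y == x then mup x p else 0%N.
  by rewrite /= count_nseq /=; case: eqVneq => [->|_]; rewrite ?mul1n ?mul0n.
rewrite (eq_bigr _ (fun y _ => cE y)) -big_mkcond /=.
have [xr|xr] := boolP (x \in rootsR p).
  by rewrite -big_filter filter_pred1_uniq ?uniq_roots // big_seq1.
rewrite big1_seq => [|y /andP[/eqP-> yr]]; last by rewrite yr in xr.
rewrite mupNroot //; apply: contra xr => px.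
by rewrite -(roots_on_rootsR p0) in_itv /= px.
Qed.

Lemma form_diagonalizes n (A : 'M[R]_n) P l (v : 'rV[C]_n) :
  diagonalizes A P l ->
  (v *m toC A *m v^t*) 0 0 = \sum_i (l 0 i)%:C * `|(v *m P^t*) 0 i| ^+ 2.
Proof.
case=> uP ->.
have -> : v *m (P ^t* *m diag_mx (toC l) *m P) *m v ^t* =
  (v *m P^t*) *m diag_mx (toC l) *m (v *m P^t*)^t*.
  by rewrite trmx_mul map_mxM /= trmxCK !mulmxA.
rewrite mul_mx_diag mxE; apply: eq_bigr => i _; rewrite !mxE.
by rewrite mulrAC mulrC normCK.
Qed.

(** The cross terms cancel because [A] is symmetric. Complex vectors, forced by the diagonalization,
    thus reduce to pairs of real ones. *)
Lemma form_ReIm n (A : 'M[R]_n) (x y : 'rV[R]_n) : A^T = A ->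
  ((toC x + 'i%C *: toC y) *m toC A *m (toC x + 'i%C *: toC y)^t*) 0 0
    = (qform A x + qform A y)%:C.
Proof.
move=> symA.
have -> : (toC x + 'i%C *: toC y)^t* = toC x^T - 'i%C *: toC y^T.
  apply/matrixP => i j; rewrite !mxE rmorphD rmorphM -mulNr.
  have ci : ('i%C : R[i])^* = - 'i%C by apply/eqP; rewrite eq_complex /= oppr0 !eqxx.
  by congr (_ + _ * _); rewrite ?ci //; apply: conjc_real.
rewrite mulmxBr !mulmxDl -!scalemxAl -!scalemxAr scalerA.
rewrite -!map_mxM -[_ * _]expr2 sqr_i.
have -> : x *m A *m y^T = y *m A *m x^T.
  transitivity (x *m A *m y^T)^T; first by apply/matrixP => i j; rewrite [RHS]mxE !ord1.
  by rewrite !trmx_mul trmxK symA mulmxA.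
rewrite /qform !mxE rmorphD /= !mulN1r.
by ring.
Qed.

(** Courant-Fischer by counting: with fewer than [k] eigenvalues below [th], some nonzero complex
    combination of the rows of [W] has no component along their eigenvectors, so its form is at
    least [th] times its squared norm. *)
Lemma form_lt_count n (A : 'M[R]_n) P l k (W : 'M[R]_(k, n)) (th : R) :
  A^T = A -> diagonalizes A P l ->
  (forall v : 'rV_k, v != 0 -> qform A (v *m W) < th * qform 1%:M (v *m W)) ->
  (k <= #|[pred i | (l 0 i < th)%R]|)%N.
Proof.
move=> symA dA hW; rewrite leqNgt; apply/negP => ltk.
have [uP eA] := dA.
set S := [pred i | _] in ltk.
pose f (i : 'I_#|S|) : 'I_n := enum_val i.
(* Coordinates of the rows of [W] along the eigenvectors with eigenvalue below [th]; with fewer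
   columns than rows, [M] has a nonzero kernel vector. *)
pose M := colsub f (toC W *m P^t*).
have : kermx M != 0.
  by rewrite -mxrank_eq0 mxrank_ker subn_eq0 -ltnNge (leq_ltn_trans (rank_leq_col _)).
case/rowV0Pn => z /sub_kermxP zM z0.
pose a := map_mx (@complex.Re R) z; pose b := map_mx (@complex.Im R) z.
have ez : z = toC a + 'i%C *: toC b.
  by apply/matrixP => i j; rewrite !mxE -complexE.
pose v := toC (a *m W) + 'i%C *: toC (b *m W).
have ev : v = z *m toC W by rewrite /v ez mulmxDl -scalemxAl !map_mxM.
pose w := v *m P^t*.
have wS i : i \in S -> w 0 i = 0.
  move=> iS; have := congr1 (fun B : 'M_(_, _) => B 0 (enum_rank_in iS i)) zM.
  rewrite [RHS]mxE => <-; rewrite /w ev -mulmxA !mxE; apply: eq_bigr => j _.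
  by rewrite [in RHS]mxE /f enum_rankK_in.
have fA := form_diagonalizes v dA.
(* The same [P] diagonalizes the identity, so squared norms are read in the same coordinates as the
   form. *)
have d1 : diagonalizes 1%:M P (const_mx 1).
  split=> //; rewrite map_mx1.
  rewrite map_const_mx.
  by rewrite diag_const_mx mulmx1 -invmx_unitary // mulVmx ?unitarymx_unit.
have f1 := form_diagonalizes v d1.
rewrite form_ReIm // in fA; rewrite form_ReIm ?trmx1 // in f1.
have : (th * (qform 1%:M (a *m W) + qform 1%:M (b *m W)))%:C
    <= (qform A (a *m W) + qform A (b *m W))%:C.
  rewrite rmorphM /= f1 fA mulr_sumr; apply: ler_sum => i _.
  rewrite [const_mx _ _ _]mxE mul1r -/w.
  have [iS|iS] := boolP (i \in S); first by rewrite wS // normr0 expr0n !mulr0.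
  by rewrite ler_wpM2r ?exprn_ge0 // lecR leNgt; apply: iS.
rewrite lecR leNgt mulrDr => /negP; apply.
have hle (c : 'rV_k) : qform A (c *m W) <= th * qform 1%:M (c *m W).
  have [->|c0] := eqVneq c 0; last exact/ltW/hW.
  by rewrite /qform !mul0mx !mxE mulr0.
have [a0|a0] := eqVneq a 0; last by apply: ltr_leD; [apply: hW | apply: hle].
apply: ler_ltD; first exact: hle.
by apply: hW; apply: contraNneq z0 => b0; rewrite ez a0 b0 !map_mx0 scaler0 addr0.
Qed.

End Spectral.

(** * Counting entries of sorted lists *)

Section SortedCount.
Variable R : rcfType.
Implicit Types (s : seq R) (th : R) (k : nat).
Let ge_ : rel R := fun x y => y <= x.
Let ge_trans : transitive ge_.
Proof. by move=> y x z; rewrite /ge_ => xy yz; apply: le_trans yz xy. Qed.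
Let ge_refl : reflexive ge_. Proof. by move=> x; rewrite /ge_. Qed.

(** In a nonincreasing list the entries below [th] form a final segment, so [k] of them cover the
    last [k] positions, the first of which is [size s - k]. *)
Lemma sorted_count_lt s th k : sorted (fun x y => y <= x) s ->
  (0 < k <= count (fun x : R => (x < th)%R) s)%N -> s`_(size s - k) < th.
Proof.
move=> ss /andP[k0 hk]; rewrite ltNge; apply/negP => hth.
move: hk; apply/negP; rewrite -ltnNge.
have ks := count_size (fun x : R => (x < th)%R) s.
have [sk|sk] := ltnP (size s) k; first exact: leq_ltn_trans ks sk.
rewrite -[in X in (count _ X < _)%N](cat_take_drop (size s - k).+1 s) count_cat.
have -> : count (fun x : R => (x < th)%R) (take (size s - k).+1 s) = 0%N.
  apply/eqP; rewrite -leqn0 leqNgt -has_count; apply/hasPn => x; case/(nthP 0) => i.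
  rewrite size_take_min leq_min => /andP[ik is_] <-; rewrite nth_take // -leNgt.
  apply: le_trans hth _.
  have ltk : (size s - k < size s)%N by clear -sk k0; lia.
  exact: (sorted_leq_nth ge_trans ge_refl 0 ss i (size s - k)%N is_ ltk ik).
rewrite add0n; apply: leq_ltn_trans (count_size _ _) _; rewrite size_drop; clear -sk k0; lia.
Qed.

Lemma sorted_count_gt s th k : sorted (fun x y => y <= x) s ->
  (0 < k <= count (fun x : R => (th < x)%R) s)%N -> th < s`_k.-1.
Proof.
move=> ss /andP[k0 hk]; rewrite ltNge; apply/negP => hth.
move: hk; apply/negP; rewrite -ltnNge.
rewrite -[in X in (count _ X < _)%N](cat_take_drop k.-1 s) count_cat.
have -> : count (fun x : R => (th < x)%R) (drop k.-1 s) = 0%N.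
  apply/eqP; rewrite -leqn0 leqNgt -has_count; apply/hasPn => x; case/(nthP 0) => i.
  rewrite size_drop nth_drop => ik <-; rewrite -leNgt.
  apply: le_trans hth.
  have lts : (k.-1 + i < size s)%N by rewrite -ltn_subRL.
  by apply: (sorted_leq_nth ge_trans ge_refl 0 ss k.-1 (k.-1 + i)); rewrite ?inE ?leq_addr ?(leq_ltn_trans _ lts) ?leq_addr.
rewrite addn0; apply: leq_ltn_trans (count_size _ _) _; rewrite size_take_min; clear -k0; lia.
Qed.
End SortedCount.

(** * Variational bounds for single eigenvalues *)

Section MinMax.
Variables (R : rcfType) (n : nat) (A : 'M[R]_n).
Hypothesis symA : A^T = A.

Let eig_sorted : sorted (fun x y => y <= x) (eigenvalues A).
Proof. by apply: sort_sorted => x y; apply: le_total. Qed.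

(** Positions start at 0, so [n - k] is the place of the [k]-th smallest eigenvalue. *)
Lemma eigenvalue_lt k (W : 'M[R]_(k, n)) th : (0 < k)%N ->
  (forall v : 'rV_k, v != 0 -> qform A (v *m W) < th * qform 1%:M (v *m W)) ->
  (eigenvalues A)`_(n - k) < th.
Proof.
move=> k0 hW; have [P [l dA]] := symmetric_diagonalizable symA.
have pe := eigenvalues_perm dA.
have := form_lt_count symA dA hW; rewrite cardE /enum_mem size_filter => hk.
have {2}-> : n = size (eigenvalues A) by rewrite (perm_size pe) size_map size_enum_ord.
apply: sorted_count_lt => //; rewrite k0 (permP pe) count_map; move: hk.
by rewrite -enumT.
Qed.

Lemma eigenvalue_gt k (W : 'M[R]_(k, n)) th : (0 < k)%N ->
  (forall v : 'rV_k, v != 0 -> th * qform 1%:M (v *m W) < qform A (v *m W)) ->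
  th < (eigenvalues A)`_k.-1.
Proof.
move=> k0 hW; have [P [l dA]] := symmetric_diagonalizable symA.
have pe := eigenvalues_perm dA.
have symNA : (- A)^T = - A by rewrite linearN /= symA.
have := @form_lt_count _ _ _ _ _ k W (- th) symNA (diagonalizesN dA).
have hN v : v != 0 -> qform (- A) (v *m W) < - th * qform 1%:M (v *m W).
  by move=> v0; rewrite /qform mulmxN !mulNmx mxE mulNr ltrN2 hW.
move/(_ hN); rewrite cardE /enum_mem size_filter => hk.
apply: sorted_count_gt => //; rewrite k0 (permP pe) count_map; move: hk.
by rewrite -enumT; congr (_ <= _)%N; apply: eq_count => i; rewrite /= !inE /= mxE ltrN2.
Qed.

(** The kernel of [D] has dimension at least [n - j]. The strict criterion is applied to it at a
    threshold halfway between the eigenvalue and [th]. *)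
Lemma eigenvalue_ge j (D : 'M[R]_(n, j)) th : (j < n)%N ->
  (forall x : 'rV_n, x *m D = 0 -> th * qform 1%:M x <= qform A x) ->
  th <= (eigenvalues A)`_(n - j.+1).
Proof.
move=> jn hD; rewrite leNgt; apply/negP => lt_th.
pose th' := ((eigenvalues A)`_(n - j.+1) + th) / 2.
have [lt1 lt2] := (midf_lt lt_th).
have rk : (n - j <= \rank (kermx D))%N.
  by rewrite mxrank_ker leq_sub2l ?rank_leq_col.
have rk0 : (0 < \rank (kermx D))%N by lia.
have [P [l dA]] := symmetric_diagonalizable symA.
have sz : size (eigenvalues A) = n.
  by rewrite (perm_size (eigenvalues_perm dA)) size_map size_enum_ord.
have rkn : (\rank (kermx D) <= n)%N by apply: rank_leq_col.
have : th' < (eigenvalues A)`_(\rank (kermx D)).-1.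
  apply: (eigenvalue_gt (W := row_base (kermx D))) => // v v0.
  have vD : v *m row_base (kermx D) *m D = 0.
    by apply/sub_kermxP; rewrite (submx_trans (submxMl _ _)) // eq_row_base.
  apply: lt_le_trans (hD _ vD); rewrite ltr_pM2r // qform1E.
  rewrite lt_neqAle sumr_ge0 ?andbT => [|i _]; last exact: sqr_ge0.
  apply: contra v0; rewrite eq_sym psumr_eq0 => [/allP e0|i _]; last exact: sqr_ge0.
  rewrite -(mulmx_free_eq0 _ (row_base_free (kermx D))).
  apply/eqP/rowP => i; have := e0 i (mem_index_enum i).
  by rewrite /= sqrf_eq0 => /eqP ->; rewrite mxE.
(* The rank minus 1 is at least [n - j - 1], and the list is nonincreasing. *)
rewrite ltNge => /negP; apply; apply: le_trans (ltW lt1).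
pose ge_ : rel R := fun x y => y <= x.
have gt_ : transitive ge_ by move=> b a c ab bc; apply: le_trans bc ab.
have gr_ : reflexive ge_ by move=> a; rewrite /ge_.
by apply: (sorted_leq_nth gt_ gr_ 0 eig_sorted); rewrite ?inE ?sz; clear -rk rk0 rkn jn; lia.
Qed.
End MinMax.

(** * Laplacian forms of a graph and of its complement *)

(* Every edge is counted twice, so this is twice the Laplacian quadratic form. *)
Definition energy (R : rcfType) (T : finType) (h : rel T) (x : T -> R) : R :=
  \sum_a \sum_b (h a b)%:R * (x a - x b) ^+ 2.

(** Stated for any symmetric relation, so that it serves both [G] and its complement. *)
Lemma energyE (R : rcfType) (T : finType) (h : rel T) (x : T -> R) :
  symmetric h -> energy h x =
  2 * (\sum_a #|[set b | h a b]|%:R * x a ^+ 2 - \sum_a \sum_b (h a b)%:R * (x a * x b)).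
Proof.
move=> hC.
have e1 : \sum_a #|[set b | h a b]|%:R * x a ^+ 2 = \sum_a \sum_b (h a b)%:R * x a ^+ 2.
  apply: eq_bigr => a _; rewrite -mulr_suml; congr (_ * _).
  rewrite -sum1_card natr_sum big_mkcond /=.
  by apply: eq_bigr => b _; rewrite inE; case: (h a b).
have e2 : \sum_a #|[set b | h a b]|%:R * x a ^+ 2 = \sum_a \sum_b (h a b)%:R * x b ^+ 2.
  rewrite e1 exchange_big; apply: eq_bigr => a _; apply: eq_bigr => b _.
  by rewrite hC.
pose c := \sum_a \sum_b (h a b)%:R * (x a * x b).
have -> : energy h x = \sum_a \sum_b (h a b)%:R * x a ^+ 2 +
    \sum_a \sum_b (h a b)%:R * x b ^+ 2 - 2 * c.
  rewrite /c mulr_sumr -big_split -sumrB; apply: eq_bigr => a _ /=.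
  rewrite mulr_sumr -big_split -sumrB; apply: eq_bigr => b _ /=; ring.
by rewrite -e1 -e2 -/c; ring.
Qed.

(** Adjacency in the complement [H]; the neighbourhoods [nbhd] below are taken there too. *)
Definition cadj (G : sgraph) : rel G := fun u v => (u != v) && ~~ adj u v.

Lemma cadj_sym G : symmetric (@cadj G).
Proof. by move=> u v; rewrite /cadj eq_sym adj_sym. Qed.

Lemma cadj_irr G : irreflexive (@cadj G).
Proof. by move=> u; rewrite /cadj eqxx. Qed.

Section Forms.
Variables (R : rcfType) (G : sgraph).
Implicit Types (x y : G -> R) (d th : R).

Definition row_of x : 'rV[R]_#|G| := \row_i x (enum_val i).

Lemma qform_row_of (A : 'M[R]_#|G|) x : qform A (row_of x) =
  \sum_a \sum_b A (enum_rank a) (enum_rank b) * (x a * x b).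
Proof.
rewrite /qform mxE (reindex_onto (@enum_rank G) (@enum_val G _)) => [|i _]; last first.
  by rewrite enum_valK.
rewrite exchange_big; apply: eq_big => [b|b _]; first by rewrite enum_rankK eqxx.
rewrite !mxE enum_rankK (reindex_onto (@enum_rank G) (@enum_val G _)) => [|i _]; last first.
  by rewrite enum_valK.
rewrite mulr_suml; apply: eq_big => [a|a _]; first by rewrite enum_rankK eqxx.
by rewrite !mxE enum_rankK; ring.
Qed.

Lemma qform_lap x : 2 * qform (laplacian_mx R G) (row_of x) = energy (@adj G) x.
Proof.
rewrite energyE ?qform_row_of; last exact: adj_sym.
congr (2 * _); rewrite -sumrB; apply: eq_bigr => a _.
rewrite (eq_bigr (fun b => (a == b)%:R * ((degree a)%:R * (x a * x b))
    - (adj a b)%:R * (x a * x b))) => [|b _].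
  rewrite sumrB (bigD1 a) //= eqxx mul1r expr2 big1 ?addr0 // => b.
  by rewrite eq_sym => /negPf ->; rewrite mul0r.
rewrite !mxE !enum_rankK mulrBl (can_eq (@enum_rankK G)); congr (_ - _).
by case: (a == b); rewrite ?mulr1n ?mulr0n ?mul1r ?mul0r.
Qed.

Lemma qform1_row_of x : qform 1%:M (row_of x) = \sum_a x a ^+ 2.
Proof.
rewrite qform_row_of; apply: eq_bigr => a _.
rewrite (bigD1 a) //= mxE eqxx mul1r expr2 big1 ?addr0 // => b.
by rewrite eq_sym !mxE (can_eq (@enum_rankK G)) => /negPf ->; rewrite mul0r.
Qed.

Lemma lap_sym : (laplacian_mx R G)^T = laplacian_mx R G.
Proof.
apply/matrixP => i j; rewrite !mxE adj_sym; congr (_ - _).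
by rewrite eq_sym; case: eqVneq => [->|].
Qed.

Lemma row_of_surj (v : 'rV[R]_#|G|) : v = row_of (fun a => v 0 (enum_rank a)).
Proof. by apply/rowP => i; rewrite mxE enum_valK. Qed.

(** The identity [L(G) + L(H) = n I - J], read as quadratic forms and doubled. *)
Lemma energy_complement x : energy (@adj G) x + energy (@cadj G) x =
  2 * (#|G|%:R * \sum_a x a ^+ 2 - (\sum_a x a) ^+ 2).
Proof.
have -> : energy (@adj G) x + energy (@cadj G) x =
    \sum_(a : G) \sum_(b : G) x a ^+ 2 + \sum_(a : G) \sum_(b : G) x b ^+ 2
    - 2 * \sum_(a : G) \sum_(b : G) x a * x b.
  rewrite mulr_sumr -!big_split -sumrB; apply: eq_bigr => a _ /=.
  rewrite mulr_sumr -!big_split -sumrB; apply: eq_bigr => b _ /=.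
  rewrite /cadj; case: eqVneq => [<-|_] /=; first by rewrite adj_irr; ring.
  by case: adj => /=; ring.
have e1 : \sum_(a : G) \sum_(b : G) x b ^+ 2 = #|G|%:R * \sum_a x a ^+ 2.
  by rewrite sumr_const mulr_natl.
have e2 : \sum_(a : G) \sum_(b : G) x a ^+ 2 = #|G|%:R * \sum_a x a ^+ 2.
  by rewrite exchange_big.
rewrite e1 e2 expr2 big_distrlr /=; ring.
Qed.

(* The span of [x], [y] and the constant vector bounds the third smallest
   eigenvalue; constants lie in the kernel of both Laplacians. *)
Lemma lap_mu_lt_span x y d : (2 < #|G|)%N -> 0 <= d < #|G|%:R ->
  (forall p q : R, (p != 0) || (q != 0) ->
     2 * d * \sum_a (p * x a + q * y a) ^+ 2
       < energy (@cadj G) (fun a => p * x a + q * y a)) ->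
  lap_mu R G (#|G| - 2) < #|G|%:R - d.
Proof.
move=> n3 /andP[d0 dn] hxy; rewrite /lap_mu.
(* The third smallest eigenvalue has index [n - 2] counted from 1, hence position [n - 3] counted
   from 0. *)
have -> : (#|G| - 2).-1 = (#|G| - 3)%N by clear -n3; lia.
pose W : 'M[R]_(3, #|G|) := \matrix_(i, j)
  (nth (fun=> 1) [:: fun=> 1; x; y] i (enum_val j)).
apply: (eigenvalue_lt lap_sym (W := W)) => // v v0.
pose v0_ := v 0 ord0; pose p := v 0 (inord 1); pose q := v 0 (inord 2).
pose z a := p * x a + q * y a.
have vW : v *m W = row_of (fun a => v0_ + z a).
  apply/rowP => j; rewrite !mxE !big_ord_recl big_ord0 !mxE /= mulr1 addr0.
  rewrite /z /v0_ /p /q; congr (_ + (_ * _ + _ * _)).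
    by congr (v 0 _); apply: val_inj; rewrite /= inordK.
  by congr (v 0 _); apply: val_inj; rewrite /= inordK.
rewrite vW qform1_row_of -(ltr_pM2l (ltr0n R 2)) qform_lap.
have -> : energy (@adj G) (fun a => v0_ + z a) = energy (@adj G) z.
  by rewrite /energy; apply: eq_bigr => a _; apply: eq_bigr => b _; congr (_ * _); ring.
have -> : \sum_a (v0_ + z a) ^+ 2 =
   \sum_a z a ^+ 2 + 2 * v0_ * \sum_a z a + #|G|%:R * v0_ ^+ 2.
  have -> : #|G|%:R * v0_ ^+ 2 = \sum_(a : G) v0_ ^+ 2 by rewrite sumr_const mulr_natl.
  rewrite mulr_sumr -!big_split /=.
  by apply: eq_bigr => a _; ring.
have eqE := energy_complement z.
set Q := \sum_a z a ^+ 2 in eqE *; set S := \sum_a z a in eqE *.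
set n := #|G|%:R in dn eqE *.
(* Once the energy in the complement is bounded below by [2 * d * Q], this completed square is what
   remains of half the gap. *)
have sq : 0 <= (S + (n - d) * v0_) ^+ 2 + (n - d) * d * v0_ ^+ 2.
  by rewrite addr_ge0 ?sqr_ge0 // mulr_ge0 ?sqr_ge0 // mulr_ge0 // subr_ge0 ltW.
have [pq|] := boolP ((p != 0) || (q != 0)).
  have := hxy p q pq; rewrite -/z -/Q => lt1; nra.
(* Only the constant part is left; half the gap is then [(n - d) * n * v0_ ^+ 2]. *)
rewrite negb_or !negbK => /andP[/eqP p0 /eqP q0].
have z0 a : z a = 0 by rewrite /z p0 q0 !mul0r addr0.
have Q0 : Q = 0 by apply: big1 => a _; rewrite z0 expr0n.
have S0 : S = 0 by apply: big1 => a _; rewrite z0.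
have nz : v0_ != 0.
  apply: contra_neq v0 => v00; apply/rowP => -[[|[|[|//]]] i3]; rewrite mxE.
  - by rewrite -v00; congr (v 0 _); apply: val_inj.
  - by rewrite -p0; congr (v 0 _); apply: val_inj; rewrite /= inordK.
  - by rewrite -q0; congr (v 0 _); apply: val_inj; rewrite /= inordK.
have E0 : energy (@adj G) z = 0.
  by rewrite /energy; apply: big1 => a _; apply: big1 => b _; rewrite !z0 subrr expr0n mulr0.
have vv : 0 < v0_ ^+ 2 by rewrite exprn_even_gt0.
have ngt0 : 0 < n by apply: le_lt_trans dn.
rewrite E0 Q0 S0 mulr0 !add0r; apply: mulr_gt0; first by rewrite ltr0n.
by apply: mulr_gt0; [rewrite subr_gt0 | apply: mulr_gt0].
Qed.

(** A strict bound on all nonzero functions lies above every eigenvalue, so any three independent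
    vectors will do; [pid_mx 3] supplies them. *)
Lemma lap_mu_lt th : (2 < #|G|)%N ->
  (forall x, 0 < \sum_a x a ^+ 2 -> energy (@adj G) x < 2 * th * \sum_a x a ^+ 2) ->
  lap_mu R G (#|G| - 2) < th.
Proof.
move=> n3 hth; rewrite /lap_mu.
have -> : (#|G| - 2).-1 = (#|G| - 3)%N by clear -n3; lia.
apply: (eigenvalue_lt lap_sym (W := pid_mx 3)) => // v v0.
have vW0 : v *m pid_mx 3 != 0 :> 'rV[R]_#|G|.
  by rewrite mulmx_free_eq0 // /row_free rank_pid_mx.
move: (v *m _) vW0 => w w0; rewrite [w]row_of_surj -(ltr_pM2l (ltr0n R 2)) qform_lap.
rewrite qform1_row_of mulrA; apply: hth.
have s0 a : true -> 0 <= w 0 (enum_rank a) ^+ 2 by rewrite sqr_ge0.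
rewrite lt_neqAle sumr_ge0 // andbT eq_sym psumr_eq0 //.
apply: contra w0 => /allP w0; apply/eqP/rowP => i.
have := w0 (enum_val i) (mem_index_enum _).
by rewrite /= enum_valK sqrf_eq0 => /eqP ->; rewrite mxE.
Qed.

(** Two linear conditions cut out a space of codimension at most 2, which controls the third
    smallest eigenvalue from below. *)
Lemma lap_mu_ge (f g : G -> R) th : (2 < #|G|)%N ->
  (forall x, \sum_a x a * f a = 0 -> \sum_a x a * g a = 0 ->
     2 * th * \sum_a x a ^+ 2 <= energy (@adj G) x) ->
  th <= lap_mu R G (#|G| - 2).
Proof.
move=> n3 hth; rewrite /lap_mu.
have -> : (#|G| - 2).-1 = (#|G| - 3)%N by clear -n3; lia.
pose D : 'M[R]_(#|G|, 2) := \matrix_(i, j) (if j == 0 then f else g) (enum_val i).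
apply: (eigenvalue_ge lap_sym (D := D)); first by clear -n3; lia.
move=> v vD; rewrite [v]row_of_surj -(ler_pM2l (ltr0n R 2)) qform_lap.
rewrite qform1_row_of mulrA.
have e j : \sum_a v 0 (enum_rank a) * (if j == 0 :> 'I_2 then f else g) a = 0.
  have := congr1 (fun B : 'M_(_, _) => B 0 j) vD; rewrite !mxE => {2}<-.
  rewrite [RHS](reindex_onto (@enum_rank G) (@enum_val G _)) => [|i _]; last first.
    by rewrite enum_valK.
  by apply: eq_big => [a|a _]; rewrite ?enum_rankK ?eqxx // mxE enum_rankK.
by apply: hth; [apply: (e 0) | apply: (e 1)].
Qed.
End Forms.

(** * Test spaces at two vertices *)

Definition nbhd (G : sgraph) (u : G) : {set G} := [set w | cadj u w].

Section TwoCenters.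
Variables (R : rcfType) (G : sgraph).
Implicit Types (x y : G -> R) (d : R) (u v : G).

Lemma sum_mem (A : {set G}) : \sum_w (w \in A)%:R = #|A|%:R :> R.
Proof.
rewrite -sum1_card natr_sum [RHS]big_mkcond /=.
by apply: eq_bigr => w _; case: (w \in A).
Qed.

Lemma sum_indicator (A : {set G}) (c : R) : \sum_w (w \in A)%:R * c = #|A|%:R * c.
Proof. by rewrite -mulr_suml sum_mem. Qed.

(** All terms of the energy are nonnegative, so edges missing both [u] and [v] may be dropped. The
    second sum omits [w = u] so that the edge [uv] is counted once. *)
Lemma energy_two_stars x u v : u != v ->
  2 * (\sum_w (cadj u w)%:R * (x u - x w) ^+ 2
       + \sum_(w | w != u) (cadj v w)%:R * (x v - x w) ^+ 2)
    <= energy (@cadj G) x.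
Proof.
move=> uv; pose f a b : R := (cadj a b)%:R * (x a - x b) ^+ 2.
have f0 a b : 0 <= f a b by rewrite mulr_ge0 ?ler0n ?sqr_ge0.
have fC a b : f a b = f b a by rewrite /f cadj_sym -sqrrN opprB.
have faa a : f a a = 0 by rewrite /f cadj_irr mul0r.
change (2 * (\sum_b f u b + \sum_(b | b != u) f v b) <= \sum_a \sum_b f a b).
have rest : \sum_(a | (a != u) && (a != v)) (f u a + f v a) <=
    \sum_(a | (a != u) && (a != v)) \sum_b f a b.
  apply: ler_sum => a /andP[au av]; rewrite (bigD1 u) //= (bigD1 v) 1?eq_sym //=.
  by rewrite addrA ![f a _]fC lerDl sumr_ge0.
have Su : \sum_b f u b = f u v + \sum_(a | (a != u) && (a != v)) f u a.
  by rewrite (bigD1 u) //= faa add0r (bigD1 v) //= eq_sym.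
have Sv : \sum_b f v b = f u v + \sum_(b | b != u) f v b.
  by rewrite (bigD1 u) //= fC.
have Sv' : \sum_(b | b != u) f v b = \sum_(a | (a != u) && (a != v)) f v a.
  by rewrite (bigD1 v) //= ?faa ?add0r // eq_sym.
rewrite [leRHS](bigD1 u) //= [X in _ <= _ + X](bigD1 v) /=; last by rewrite eq_sym.
move: rest; rewrite big_split /= -Sv'; lra.
Qed.

(* Test vectors: [p] at [u], [q] at [v], the linear forms [p aX + q bX] on the
   sets [X] = [A], [B], [C], and 0 elsewhere. *)
Lemma two_centers (u v : G) (A : {set G}) (aA bA aB bB aC bC d : R) :
  let B := (nbhd v :\: nbhd u) :\ u in
  let C := nbhd u :&: nbhd v in
  (2 < #|G|)%N -> 0 <= d < #|G|%:R -> u != v ->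
  A \subset (nbhd u :\: nbhd v) :\ v ->
  (forall p q : R, (p != 0) || (q != 0) ->
    d * (p ^+ 2 + q ^+ 2 + #|A|%:R * (p * aA + q * bA) ^+ 2
      + #|B|%:R * (p * aB + q * bB) ^+ 2 + #|C|%:R * (p * aC + q * bC) ^+ 2)
    < (cadj u v)%:R * (p - q) ^+ 2 + #|A|%:R * (p - (p * aA + q * bA)) ^+ 2
      + (#|nbhd u|%:R - (cadj u v)%:R - #|A|%:R - #|C|%:R) * p ^+ 2
      + #|B|%:R * (q - (p * aB + q * bB)) ^+ 2
      + #|C|%:R * ((p - (p * aC + q * bC)) ^+ 2 + (q - (p * aC + q * bC)) ^+ 2)) ->
  lap_mu R G (#|G| - 2) < #|G|%:R - d.
Proof.
move=> B C n3 hd uv sA hpq.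
pose val_ (eu ev eA eB eC : R) (w : G) : R :=
  if w == u then eu else if w == v then ev else
  if w \in A then eA else if w \in B then eB else if w \in C then eC else 0.
apply: (lap_mu_lt_span (x := val_ 1 0 aA aB aC) (y := val_ 0 1 bA bB bC)) => // p q pq.
pose z a := p * val_ 1 0 aA aB aC a + q * val_ 0 1 bA bB bC a.
suff : 2 * d * \sum_a z a ^+ 2 < energy (@cadj G) z by [].
set fA := p * aA + q * bA; set fB := p * aB + q * bB; set fC := p * aC + q * bC.
have zE w : z w = val_ p q fA fB fC w.
  by rewrite /z /val_; do !case: ifP => _; rewrite ?mulr0 ?mulr1 ?addr0 ?add0r.
have inA w : w \in A -> [/\ cadj u w, ~~ cadj v w & w != v].
  by move/(subsetP sA); rewrite !inE => /and3P[].
have u_A : u \notin A by apply/negP => /inA[]; rewrite cadj_irr.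
have z_u : z u = p by rewrite zE /val_ eqxx.
have z_v : z v = q by rewrite zE /val_ eqxx eq_sym (negPf uv).
rewrite -mulrA; apply: lt_le_trans (energy_two_stars z uv); rewrite ltr_pM2l ?ltr0n //.
have := hpq p q pq; rewrite -/fA -/fB -/fC.
(* Each side is rewritten through sums over vertices, which are compared vertex by vertex. *)
congr (_ < _).
- congr (d * _).
  rewrite -(sum_indicator A) -(sum_indicator B) -(sum_indicator C).
  have -> : p ^+ 2 = \sum_w (w \in [set u])%:R * p ^+ 2 by rewrite sum_indicator cards1 mul1r.
  have -> : q ^+ 2 = \sum_w (w \in [set v])%:R * q ^+ 2 by rewrite sum_indicator cards1 mul1r.
  rewrite -!big_split /=; apply: eq_bigr => w _; rewrite zE /val_ !inE.
  have [->|wu] := eqVneq w u.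
    by rewrite (negPf uv) (negPf u_A) !cadj_irr /=; ring.
  have [->|wv] := eqVneq w v.
    have v_A : v \in A = false by apply/negP => /inA[]; rewrite eqxx.
    by rewrite v_A !cadj_irr !andbF /=; ring.
  have [wA|wA] := boolP (w \in A).
    by have [-> /negPf -> _] := inA w wA; rewrite /=; ring.
  by case: (cadj u w); case: (cadj v w) => /=; ring.
- rewrite z_u z_v.
  (* Writing the indicator of the edge [uv] as a cardinality turns its contribution into a sum over
     vertices as well. *)
  pose v1 : {set G} := if cadj u v then [set v] else set0.
  have cv1 : (cadj u v)%:R = #|v1|%:R :> R by rewrite /v1; case: cadj; rewrite ?cards1 ?cards0.
  have v1E w : (w \in v1) = (cadj u v) && (w == v) by rewrite /v1; case: cadj; rewrite inE.
  have -> : \sum_w (cadj u w)%:R * (p - z w) ^+ 2 =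
      (cadj u v)%:R * (p - q) ^+ 2 + #|A|%:R * (p - fA) ^+ 2 + #|C|%:R * (p - fC) ^+ 2
      + (#|nbhd u|%:R - (cadj u v)%:R - #|A|%:R - #|C|%:R) * p ^+ 2.
    rewrite cv1 -!sum_mem -!sumrB !mulr_suml -!big_split /=; apply: eq_bigr => w _.
    rewrite zE /val_ v1E !inE.
    have [->|wu] := eqVneq w u.
      by rewrite (negPf uv) (negPf u_A) !cadj_irr ?andbF /=; ring.
    have [->|wv] := eqVneq w v.
      have v_A : v \in A = false by apply/negP => /inA[]; rewrite eqxx.
      by rewrite v_A !cadj_irr !andbF /= andbT; case: (cadj u v) => /=; ring.
    rewrite andbF.
    have [wA|wA] := boolP (w \in A).
      by have [-> /negPf -> _] := inA w wA; rewrite /=; ring.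
    by case: (cadj u w); case: (cadj v w) => /=; ring.
  have -> : \sum_(w | w != u) (cadj v w)%:R * (q - z w) ^+ 2 =
      #|B|%:R * (q - fB) ^+ 2 + #|C|%:R * (q - fC) ^+ 2.
    rewrite big_mkcond -!sum_mem !mulr_suml -!big_split /=; apply: eq_bigr => w _.
    rewrite zE /val_ !inE.
    have [->|wu] := eqVneq w u.
      by rewrite !cadj_irr ?andbF /=; ring.
    have [->|wv] := eqVneq w v.
      by rewrite !cadj_irr !andbF /=; ring.
    have [wA|wA] := boolP (w \in A).
      by have [-> /negPf -> _] := inA w wA; rewrite /=; ring.
    by case: (cadj u w); case: (cadj v w) => /=; ring.
  ring.
Qed.
End TwoCenters.

(** After multiplication by [a], completing the square leaves the determinant times [q ^+ 2]. *)
Lemma quadratic_form_gt0 (R : realFieldType) (a b c p q : R) :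
  0 < a -> b ^+ 2 < a * c -> (p != 0) || (q != 0) ->
  0 < a * p ^+ 2 + 2 * b * p * q + c * q ^+ 2.
Proof.
move=> a0 hbc pq; rewrite -(pmulr_rgt0 _ a0).
have -> : a * (a * p ^+ 2 + 2 * b * p * q + c * q ^+ 2) =
  (a * p + b * q) ^+ 2 + (a * c - b ^+ 2) * q ^+ 2 by ring.
have [q0|q0] := eqVneq q 0.
  move: pq; rewrite q0 eqxx orbF => p0.
  by rewrite mulr0 addr0 expr0n mulr0 addr0 exprn_even_gt0 //= mulf_neq0 // gt_eqF.
by rewrite ltr_wpDl ?sqr_ge0 // mulr_gt0 ?subr_gt0 // exprn_even_gt0.
Qed.

Lemma sumsq_gt0 (R : realFieldType) (p q : R) :
  (p != 0) || (q != 0) -> 0 < p ^+ 2 + q ^+ 2.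
Proof.
move=> pq; have := @quadratic_form_gt0 R 1 0 1 p q ltr01 _ pq.
by rewrite mulr0 !mul0r addr0 !mul1r; apply; rewrite expr0n ?mul1r ltr01.
Qed.

(** * Local configurations that force strictness *)

Section Strict.
Variables (R : rcfType) (G : sgraph).
Implicit Types (d : R) (u v w : G).
Hypothesis n3 : (2 < #|G|)%N.

Lemma card_nbhd u v : u != v ->
  (#|(nbhd v :\: nbhd u) :\ u| + #|nbhd u :&: nbhd v| + cadj u v = #|nbhd v|)%N.
Proof.
move=> uv; rewrite -(cardsID (nbhd u) (nbhd v)) setIC.
rewrite [in RHS](cardsD1 u (_ :\: _)) !inE cadj_irr /= cadj_sym; lia.
Qed.

(** On the unit vectors at [u] and [v] the difference of the two sides is diagonal, with entries
    degree minus [d]. *)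
Lemma lt_nonadjacent d u v : 0 <= d < #|G|%:R -> u != v -> ~~ cadj u v ->
  d < #|nbhd u|%:R -> d < #|nbhd v|%:R -> lap_mu R G (#|G| - 2) < #|G|%:R - d.
Proof.
move=> dn uv nuv du dv.
apply: (@two_centers R G u v set0 0 0 0 0 0 0 d) => // [|p q pq]; first exact: sub0set.
have := card_nbhd uv; rewrite (negPf nuv) addn0.
move/(congr1 (fun m => m%:R : R)); rewrite natrD cards0 => e.
rewrite -subr_gt0; set lhs := (X in 0 < X).
have -> : lhs = (#|nbhd u|%:R - d) * p ^+ 2 + 2 * 0 * p * q + (#|nbhd v|%:R - d) * q ^+ 2.
  by rewrite /lhs -e /=; ring.
apply: quadratic_form_gt0 => //; rewrite ?subr_gt0 //.
by rewrite expr0n mulr_gt0 ?subr_gt0.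
Qed.

(** With [k = #|nbhd v|], centres [p = q] put [- p / (k - 1)] on the chosen neighbours, and opposite
    centres put 0 there. A common neighbour supplies strictness when [d = k]. *)
Lemma lt_adjacent d u v : 0 <= d < #|G|%:R -> u != v -> cadj u v ->
  (1 < #|nbhd v| <= #|nbhd u|)%N ->
  (d < #|nbhd v|%:R) || (d <= #|nbhd v|%:R) && (nbhd u :&: nbhd v != set0) ->
  lap_mu R G (#|G| - 2) < #|G|%:R - d.
Proof.
move=> dn uv auv /andP[k2 ku] hd.
have eB := card_nbhd uv; rewrite auv in eB.
have := @card_nbhd v u; rewrite eq_sym cadj_sym auv setIC => /(_ uv) eA.
(* The private part of [nbhd u] may be larger; a subset [A] of the size of the private part of
   [nbhd v] restores the symmetry. *)
have : (#|(nbhd v :\: nbhd u) :\ u| <= #|(nbhd u :\: nbhd v) :\ v|)%N by lia.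
case/card_geqP => s [us sb ss].
pose A := [set w in s].
have cA : #|A| = #|(nbhd v :\: nbhd u) :\ u| by rewrite cardsE (card_uniqP us).
have sA : A \subset (nbhd u :\: nbhd v) :\ v by apply/subsetP => w; rewrite inE => /ss.
pose g : R := (2 * (#|nbhd v|%:R - 1))^-1.
apply: (@two_centers R G u v A (- g) (- g) (- g) (- g) (- g) (- g) d) => // p q pq.
rewrite cA auv; set b := #|_ :\ _| in eB *; set c := #|nbhd u :&: nbhd v| in eB hd *.
have eB' : b%:R + c%:R + 1 = #|nbhd v|%:R :> R by rewrite -eB !natrD.
have m0 : 0 < b%:R + c%:R :> R by rewrite -natrD ltr0n; lia.
have hu : b%:R + c%:R + 1 <= #|nbhd u|%:R :> R by rewrite eB' ler_nat.
have hd' : (d < b%:R + c%:R + 1) || (d <= b%:R + c%:R + 1) && (0 < c%:R :> R).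
  by rewrite eB' ltr0n card_gt0.
have gE : g = (2 * (b%:R + c%:R))^-1 by rewrite /g -eB' addrK.
have b0 : 0 <= b%:R :> R by rewrite ler0n.
have c0 : 0 <= c%:R :> R by rewrite ler0n.
move: b%:R c%:R b0 c0 m0 hu hd' gE => b' c' b0 c0 m0 hu hd' gE; clear b c eB eB' eA ss.
move: b' c' b0 c0 m0 hu hd' gE => b c b0 c0 m0 hu hd' gE.
move: (#|nbhd u|%:R) hu => e hu.
set m := b + c in m0 hu hd' gE.
have m1 : m != 0 by rewrite gt_eqF.
have p2 := sumsq_gt0 pq.
set N := (X in d * X); rewrite -subr_gt0.
have N0 : 0 < N.
  by rewrite /N; do 3?[apply: ltr_wpDr; first by rewrite mulr_ge0 ?sqr_ge0].
set D := (X in 0 < X).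
(* Every term is nonnegative. The second decides when [d < k]; otherwise the third does if
   [p + q = 0] and the fourth if not. *)
have -> : D = (e - 1 - m) * p ^+ 2 + (m + 1 - d) * N + (p - q) ^+ 2 / 2
      + (m + 1) * c / (4 * m ^+ 2) * (p + q) ^+ 2.
  rewrite /D /N gE /m /=; field; exact: m1.
have e0 : 0 <= (e - 1 - m) * p ^+ 2 by rewrite mulr_ge0 ?sqr_ge0 //; lra.
have t0 : 0 <= (p - q) ^+ 2 / 2 by rewrite divr_ge0 ?sqr_ge0 ?ler0n.
have m4 : 0 < 4 * m ^+ 2 by rewrite mulr_gt0 ?ltr0n // exprn_gt0.
have K0 : 0 <= (m + 1) * c / (4 * m ^+ 2).
  by apply: divr_ge0; [apply: mulr_ge0; lra | apply: ltW].
have Ks0 : 0 <= (m + 1) * c / (4 * m ^+ 2) * (p + q) ^+ 2 by rewrite mulr_ge0 ?sqr_ge0.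
case/orP: hd' => [lt_d|/andP[le_d cpos]].
  have : 0 < (m + 1 - d) * N by rewrite mulr_gt0 ?subr_gt0.
  lra.
have dN : 0 <= (m + 1 - d) * N by rewrite mulr_ge0 ?subr_ge0 // ltW.
have K1 : 0 < (m + 1) * c / (4 * m ^+ 2) by rewrite divr_gt0 // mulr_gt0 //; lra.
have [pq0|pq0] := eqVneq (p + q) 0.
  have : 0 < (p - q) ^+ 2 / 2.
    rewrite divr_gt0 ?ltr0n // exprn_even_gt0 //=; apply: contraTneq p2 => pq1.
    have -> : p = 0 by lra.
    have -> : q = 0 by lra.
    by rewrite expr0n addr0 ltxx.
  lra.
have : 0 < (m + 1) * c / (4 * m ^+ 2) * (p + q) ^+ 2.
  by rewrite mulr_gt0 // exprn_even_gt0.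
lra.
Qed.

(* Test vectors: [p] at [u], [q] at [v] and [- q / k] on the neighbours of [v]. *)
Lemma lt_star_nonadjacent d u v : 0 <= d < #|G|%:R -> u != v -> ~~ cadj u v ->
  let t := #|nbhd u|%:R - d in
  let k : R := #|nbhd v|%:R in
  let c := #|nbhd u :&: nbhd v|%:R in
  0 < t -> 0 < k -> c ^+ 2 < t * (c + (k + 1 - d) * k * (k + 1)) ->
  lap_mu R G (#|G| - 2) < #|G|%:R - d.
Proof.
move=> dn uv nuv t k c t0 k0 hc.
have := card_nbhd uv; rewrite (negPf nuv) addn0 => /(congr1 (fun m => m%:R : R)).
rewrite natrD -/k -/c => eB.
apply: (@two_centers R G u v set0 0 0 0 (- k^-1) 0 (- k^-1) d) => // [|p q pq].
  exact: sub0set.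
rewrite cards0 (negPf nuv) -/c; set b := #|_ :\ _|%:R in eB *.
rewrite -subr_gt0; set D := (X in 0 < X).
have kn : k != 0 by rewrite gt_eqF.
have -> : D = t * p ^+ 2 + 2 * (c / k) * p * q
   + (c / k ^+ 2 + (k + 1) / k * (k + 1 - d)) * q ^+ 2.
  rewrite /D /t; have -> : b = k - c by rewrite -eB addrK.
  by rewrite /=; field.
apply: quadratic_form_gt0 => //.
(* The hypothesis on [c] is the determinant condition multiplied by [k ^+ 2]. *)
rewrite -subr_gt0 (_ : _ - _ = (t * (c + (k + 1 - d) * k * (k + 1)) - c ^+ 2) / k ^+ 2).
  by rewrite divr_gt0 ?subr_gt0 // exprn_gt0.
by field.
Qed.

(* Test vectors: [p] at [u], [q] at [v] and [- a q] on the other neighbours of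
   [v]. *)
Lemma lt_star_adjacent d (a : R) u v : 0 <= d < #|G|%:R -> u != v -> cadj u v ->
  let t := #|nbhd u|%:R - d in
  let k : R := #|nbhd v|%:R in
  let c := #|nbhd u :&: nbhd v|%:R in
  0 < t ->
  (c * a - 1) ^+ 2 < t * (1 + c * a ^+ 2 + (k - 1) * (1 + a) ^+ 2
                          - d * (1 + (k - 1) * a ^+ 2)) ->
  lap_mu R G (#|G| - 2) < #|G|%:R - d.
Proof.
move=> dn uv auv t k c t0 hc.
have := card_nbhd uv; rewrite auv => /(congr1 (fun m => m%:R : R)).
rewrite !natrD -/k -/c => eB.
apply: (@two_centers R G u v set0 0 0 0 (- a) 0 (- a) d) => // [|p q pq].
  exact: sub0set.
rewrite cards0 auv -/c; set b := #|_ :\ _|%:R in eB *.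
rewrite -subr_gt0; set D := (X in 0 < X).
have -> : D = t * p ^+ 2 + 2 * (c * a - 1) * p * q + (1 + c * a ^+ 2
   + (k - 1) * (1 + a) ^+ 2 - d * (1 + (k - 1) * a ^+ 2)) * q ^+ 2.
  by rewrite /D /t -eB /=; ring.
exact: quadratic_form_gt0.
Qed.

(** The private neighbours of [u] get [- p / k], those of [v] get [- q / k], common ones 0. The form
    is diagonal, and the nonempty private parts give a positive surplus even at [d = k]. *)
Lemma lt_not_twins d u v : 0 <= d < #|G|%:R -> u != v -> ~~ cadj u v ->
  #|nbhd u| = #|nbhd v| -> nbhd u != nbhd v -> d <= #|nbhd v|%:R ->
  lap_mu R G (#|G| - 2) < #|G|%:R - d.
Proof.
move=> dn uv nuv euv nN dk.
have eB := card_nbhd uv; rewrite (negPf nuv) addn0 in eB.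
have := @card_nbhd v u; rewrite eq_sym cadj_sym (negPf nuv) addn0 setIC => /(_ uv) eA.
set A := (_ :\ v) in eA; set B := (_ :\ u) in eB.
have eAB : #|A| = #|B| by lia.
have B0 : (0 < #|B|)%N.
  rewrite lt0n; apply: contra nN => b0; rewrite eqEcard euv leqnn andbT.
  rewrite -setD_eq0 -cards_eq0.
  rewrite (_ : nbhd u :\: nbhd v = A) ?eAB //.
  apply/setP => w; rewrite !inE; case: eqVneq => [->|] //=.
  by rewrite (negPf nuv) andbF.
pose k : R := #|nbhd v|%:R.
have k0 : 0 < k by rewrite ltr0n; lia.
have kn : k != 0 by rewrite gt_eqF.
apply: (@two_centers R G u v A (- k^-1) 0 0 (- k^-1) 0 0 d) => // p q pq.
have p2 := sumsq_gt0 pq.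
rewrite eAB (negPf nuv) euv -/B -/k; set b : R := #|B|%:R; set c : R := #|_ :&: _|%:R.
have b0 : 0 < b by rewrite ltr0n.
have ek : k = b + c by rewrite -natrD eB.
rewrite -subr_gt0; set D := (X in 0 < X).
have -> : D = ((k - d) * (1 + b / k ^+ 2) + (b / k + b / k ^+ 2)) * (p ^+ 2 + q ^+ 2).
  have ec : c = k - b by rewrite ek addrC addKr.
  by rewrite /D ec /=; field.
have b1 : 0 < b / k by rewrite divr_gt0.
have b2 : 0 < b / k ^+ 2 by rewrite divr_gt0 // exprn_gt0.
by rewrite mulr_gt0 // ltr_wpDl ?addr_gt0 // mulr_ge0 ?subr_ge0 // addr_ge0 // ltW.
Qed.

(** The difference of the unit vectors at the two leaves has Rayleigh quotient 1 and no cross term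
    with the unit vector at [u], whose quotient is at least 2. *)
Lemma lt_two_leaves d u v w : 0 <= d < 1 -> u != v -> v != w ->
  nbhd v = [set u] -> nbhd w = [set u] ->
  lap_mu R G (#|G| - 2) < #|G|%:R - d.
Proof.
move=> /andP[d0 d1] uv vw Nv Nw.
have auv : cadj u v by rewrite cadj_sym; have := set11 u; rewrite -Nv inE.
have auw : cadj u w by rewrite cadj_sym; have := set11 u; rewrite -Nw inE.
have nvw : cadj v w = false.
  by have := in_set1 w u; rewrite -Nv inE => ->; apply: contraTF auw => /eqP->; rewrite cadj_irr.
have dn : 0 <= d < #|G|%:R.
  by rewrite d0 (lt_trans d1) // ltr1n; apply: leq_trans n3.
have C0 : nbhd u :&: nbhd v = set0.
  by apply/setP => x; rewrite Nv !inE; case: eqVneq => [->|]; rewrite ?cadj_irr ?andbF.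
have B0 : (nbhd v :\: nbhd u) :\ u = set0.
  by apply/setP => x; rewrite Nv !inE; case: eqVneq => /=; rewrite ?andbF.
apply: (@two_centers R G u v [set w] 0 (-1) 0 0 0 0 d) => // [|p q pq].
  by rewrite sub1set !inE auw nvw eq_sym vw.
rewrite C0 B0 cards0 cards1 auv.
have eu : (2 <= #|nbhd u|)%N.
  by rewrite (cardsD1 v) (cardsD1 w) !inE auv auw eq_sym vw.
have eu' : 2 <= #|nbhd u|%:R :> R by rewrite ler_nat.
rewrite -subr_gt0; set D := (X in 0 < X).
have -> : D = (#|nbhd u|%:R - d) * p ^+ 2 + 2 * 0 * p * q + (2 - 2 * d) * q ^+ 2.
  by rewrite /D /=; ring.
apply: quadratic_form_gt0 => //; first by lra.
by rewrite expr0n mulr_gt0 //; lra.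
Qed.
End Strict.

(** * Graphs with a strict inequality *)

(** [D] and [k] are the degrees of the centres and [c] counts common neighbours. The bound on
    [n * d] expresses that all vertices except the heavy one have degree at most [k]. *)
Lemma nonadjacent_star_bound (R : realFieldType) (D k c n d : R) :
  0 <= c <= k -> 2 <= k -> k + 1 <= D -> D + 2 <= n -> k <= d < D ->
  n * d <= D + (n - 1) * k ->
  c ^+ 2 < (D - d) * (c + (k + 1 - d) * k * (k + 1)).
Proof.
move=> /andP[c0 ck] k2 kD Dn /andP[kd dD] nd.
pose t := D - d; pose ep := k + 1 - d; pose j := D - k - 1; pose s := k + j + 3.
have t0 : 0 < t by rewrite /t subr_gt0.
have j0 : 0 <= j by rewrite /j; lra.
have s0 : 0 < s by rewrite /s; lra.
have ns : s <= n by rewrite /s /j; lra.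
(* Replacing [n] by [s = D + 2] in the average bound keeps [ep = k + 1 - d] away from 0. *)
have eps : k + 2 <= ep * s.
  have h1 : s * (d - k) <= n * (d - k) by rewrite ler_wpM2r // subr_ge0.
  have h2 : ep * s = s - s * (d - k) by rewrite /ep; ring.
  have h3 : n * (d - k) <= D - k by move: nd; rewrite mulrBr mulrBl mul1r; lra.
  have ss : s = D + 2 by rewrite /s /j; ring.
  by rewrite h2; move: (s * _) (n * _) h1 h3 => X Y h1 h3; rewrite ss; lra.
have ep0 : 0 < ep by rewrite -(pmulr_lgt0 _ s0); lra.
rewrite -/t -/ep.
have te : t = j + ep by rewrite /t /j /ep; ring.
have sE : s = k + j + 3 by [].
clearbody t ep j s.
have k0 : 0 < k by lra.
have ek0 : 0 < ep * k * (k + 1) by rewrite !mulr_gt0 //; lra.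
have [ct|tc] := lerP c t.
  have h1 : c ^+ 2 <= t * c by rewrite expr2 ler_wpM2r.
  have h2 : 0 < t * (ep * k * (k + 1)) by rewrite mulr_gt0.
  by rewrite mulrDr; lra.
(* When [t < c], the worst case is [c = k]. *)
have h1 : c * (c - t) <= k * (k - t).
  by apply: ler_pM => //; lra.
suff h2 : k < t * (ep * (k + 1) + 1).
  have h3 : k * k < k * (t * (ep * (k + 1) + 1)) by rewrite ltr_pM2l.
  have -> : t * (c + ep * k * (k + 1)) = k * (t * (ep * (k + 1) + 1)) - t * k + t * c by ring.
  by lra.
(* Scaling by [s ^+ 2] lets [ep] be estimated through [k + 2 <= ep * s]; what is left is a
   polynomial in [j] and [k] with nonnegative coefficients. *)
rewrite -(ltr_pM2l (exprn_gt0 2 s0)).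
have -> : s ^+ 2 * (t * (ep * (k + 1) + 1)) =
   (j * s + ep * s) * (ep * s * (k + 1) + s) by rewrite te; ring.
have h4 : (j * s + (k + 2)) * ((k + 2) * (k + 1) + s) <=
   (j * s + ep * s) * (ep * s * (k + 1) + s).
  have js : 0 <= j * s by rewrite mulr_ge0 // ltW.
  have kk : 0 <= (k + 2) * (k + 1) by rewrite mulr_ge0 //; lra.
  have ee : (k + 2) * (k + 1) <= ep * s * (k + 1) by rewrite ler_wpM2r //; lra.
  by apply: ler_pM; lra.
apply: lt_le_trans h4; rewrite -subr_gt0 sE.
have -> : (j * (k + j + 3) + (k + 2)) * ((k + 2) * (k + 1) + (k + j + 3)) -
    (k + j + 3) ^+ 2 * k =
  j ^+ 3 + (k ^+ 2 + 4 * k + 8) * j ^+ 2 + (k ^+ 3 + 5 * k ^+ 2 + 12 * k + 17) * j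
   + 4 * k + 10 by ring.
have k02 : 0 <= k ^+ 2 by apply: sqr_ge0.
have k03 : 0 <= k ^+ 3 by rewrite exprn_ge0 // ltW.
have a1 : 0 <= j ^+ 3 by rewrite exprn_ge0.
have a2 : 0 <= (k ^+ 2 + 4 * k + 8) * j ^+ 2 by rewrite mulr_ge0 ?sqr_ge0 //; lra.
have a3 : 0 <= (k ^+ 3 + 5 * k ^+ 2 + 12 * k + 17) * j by rewrite mulr_ge0 //; lra.
lra.
Qed.

(** The weight [1 / (d - 1)] maximizes [(1 + a) ^+ 2 - d * a ^+ 2], the gain per neighbour if common
    neighbours are left aside. [b] counts the neighbours of the light centre, other than the heavy
    one, that are not adjacent to the heavy one. *)
Lemma adjacent_star_bound (R : realFieldType) (D k c n d b : R) :
  0 <= c -> 1 <= b -> b + c + 1 = k -> 2 <= k -> 2 <= n -> k <= d < D ->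
  n * (d - k) <= D - k - b ->
  2 * n < n * k * (k + 1 - d) ->
  (c * (d - 1)^-1 - 1) ^+ 2 < (D - d) * (1 + c * (d - 1)^-1 ^+ 2
    + (k - 1) * (1 + (d - 1)^-1) ^+ 2 - d * (1 + (k - 1) * (d - 1)^-1 ^+ 2)).
Proof.
move=> c0 b1 bck k2 n2 /andP[kd dD] h1 h2.
pose K := d - 1; pose t := D - d.
have K0 : 0 < K by rewrite /K; lra.
have Kn : K != 0 by rewrite gt_eqF.
have dK : d = K + 1 by rewrite /K; ring.
rewrite -/K -subr_gt0 -(pmulr_rgt0 _ (exprn_gt0 2 K0)) -/t.
set X := (X in 0 < X).
(* It remains to bound [(K - c) ^+ 2] by the product: [K - c] is positive, at most [t], and less
   than the other factor. *)
have -> : X = t * (K * ((k + 1 - d) * d - 1) + c) - (K - c) ^+ 2.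
  by rewrite /X dK; field.
have n0 : 0 < n by lra.
have ed : 2 < (k + 1 - d) * d.
  have h3 : 2 < k * (k + 1 - d) by move: h2; rewrite mulrC -mulrA ltr_pM2l.
  have ep0 : 0 < k + 1 - d by rewrite -(pmulr_rgt0 (x := k)) //; lra.
  by apply: lt_le_trans h3 _; rewrite mulrC ler_pM2l.
have tK : K - c <= t.
  have h4 : 2 * (d - k) <= n * (d - k) by rewrite ler_wpM2r // subr_ge0.
  by rewrite /t /K; lra.
have Kc : 0 < K - c by rewrite /K; lra.
have h5 : K - c < K * ((k + 1 - d) * d - 1) + c.
  have : K * 1 < K * ((k + 1 - d) * d - 1) by rewrite ltr_pM2l //; lra.
  lra.
rewrite subr_gt0 expr2; apply: le_lt_trans (_ : t * (K - c) < _).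
  by rewrite ler_pM2r.
by rewrite ltr_pM2l //; lra.
Qed.

Lemma card_nbhd_lt (G : sgraph) (u : G) : (#|nbhd u| < #|G|)%N.
Proof.
have : nbhd u \subset [set~ u].
  by apply/subsetP => w; rewrite !inE; apply: contraTneq => ->; rewrite cadj_irr.
have : (0 < #|G|)%N by apply/card_gt0P; exists u.
by move=> n0 /subset_leq_card; rewrite cardsC1; clear -n0; lia.
Qed.

Lemma sum_split1 (G : sgraph) (u : G) (F : G -> nat) :
  (\sum_w F w = F u + \sum_(w in nbhd u) F w + \sum_(w in ~: (u |: nbhd u)) F w)%N.
Proof.
rewrite (bigD1 u) //= (bigID (mem (nbhd u))) /= addnA; congr (_ + _ + _)%N.
  by apply: eq_bigl => w; rewrite inE; case: eqVneq => [->|]; rewrite ?cadj_irr.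
by apply: eq_bigl => w; rewrite !inE negb_or.
Qed.

Section Cases.
Variables (R : rcfType) (G : sgraph) (d : R).
Hypothesis n3 : (2 < #|G|)%N.
Hypothesis d_avg : #|G|%:R * d = (\sum_(u : G) #|nbhd u|)%:R.

Let n_gt0 : 0 < #|G|%:R :> R. Proof. by rewrite ltr0n; lia. Qed.

Lemma avg_range : 0 <= d < #|G|%:R.
Proof.
rewrite -(pmulr_rge0 _ n_gt0) d_avg ler0n -(ltr_pM2l n_gt0) d_avg -natrM ltr_nat.
apply: (@leq_ltn_trans (\sum_(u : G) #|G|.-1)).
  by apply: leq_sum => u _; have := card_nbhd_lt u; lia.
by rewrite sum_nat_const ltn_pmul2l; move: n3; set n := #|_|; lia.
Qed.

(** Three cases: a vertex of degree [k] not adjacent to [u]; a neighbour of [u] of degree [k] whose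
    other neighbours are all adjacent to [u]; neither, and then the degree sum is small enough for
    the star at [v]. *)
Lemma lt_heavy (u v : G) : u != v -> #|nbhd v|%:R <= d < #|nbhd u|%:R ->
  (1 < #|nbhd v|)%N -> (forall w, w != u -> #|nbhd w| <= #|nbhd v|)%N ->
  lap_mu R G (#|G| - 2) < #|G|%:R - d.
Proof.
move=> uv /andP[kd dD] k2 maxv.
set k := #|nbhd v| in kd k2 maxv; set D := #|nbhd u| in dD.
have dn := avg_range.
have kD : (k < D)%N by rewrite -(ltr_nat R); apply: le_lt_trans dD.
have kR : 2 <= k%:R :> R by rewrite ler_nat.
have DkR : k%:R + 1 <= D%:R :> R by rewrite natr1 ler_nat.
pose W := ~: (u |: nbhd u).
have cW : (#|W| + D + 1)%N = #|G|.
  have := cardsC (u |: nbhd u); rewrite cardsU1 inE cadj_irr -/W -/D; clear; lia.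
have sumE := sum_split1 u (fun w => #|nbhd w|); rewrite -/D -/W in sumE.
have W_neq w : w \in W -> w != u /\ ~~ cadj u w.
  by rewrite !inE negb_or => /andP[].
have N_neq w : w \in nbhd u -> w != u.
  by rewrite inE; apply: contraTneq => ->; rewrite cadj_irr.
have EN1 : (\sum_(w in nbhd u) #|nbhd w| <= D * k)%N.
  by rewrite -sum_nat_const; apply: leq_sum => w /N_neq /maxv.
have [w /andP[/andP[wu nuw] /eqP wk]|noU1] :=
    pickP (fun w => (w != u) && ~~ cadj u w && (#|nbhd w| == k)).
  have EW1 : (\sum_(w in W) #|nbhd w| <= #|W| * k)%N.
    by rewrite -sum_nat_const; apply: leq_sum => x /W_neq[/maxv].
  apply: (@lt_star_nonadjacent R G n3 d u w) => //.
  - by rewrite eq_sym.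
  - by rewrite subr_gt0.
  - by rewrite wk; lra.
  rewrite wk; apply: (nonadjacent_star_bound (n := #|G|%:R)) => //.
  - by rewrite ler0n ler_nat -wk subset_leq_card ?subsetIr.
  - have W0 : (0 < #|W|)%N by apply/card_gt0P; exists w; rewrite !inE negb_or wu.
    by rewrite -natrD ler_nat; clear -W0 cW; lia.
  - by rewrite kd.
  have -> : #|G|%:R - 1 = (#|W| + D)%:R :> R by rewrite -cW natrD addrK.
  by rewrite d_avg -natrM -natrD ler_nat sumE; clear -EN1 EW1 cW; nia.
have lowW w : w \in W -> (#|nbhd w| <= k.-1)%N.
  move=> /W_neq[wu nuw]; have := noU1 w; rewrite wu nuw /= => /negbT nk.
  by have := maxv w wu; clear -nk; lia.
have auv : cadj u v.
  by apply: contraFT (noU1 v) => nuv; rewrite eq_sym uv nuv eqxx.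
have vu : v != u by rewrite eq_sym.
pose out w := #|nbhd w :&: W|.
have nb_out w : w \in nbhd u -> (#|nbhd u :&: nbhd w| + out w + 1 = #|nbhd w|)%N.
  move=> wN; rewrite /out -[#|nbhd w|](cardsID W) setIC.
  have -> : nbhd w :\: W = u |: (nbhd u :&: nbhd w).
    apply/setP => x; rewrite !inE negbK; case: eqVneq => [->|] //=.
    by rewrite cadj_sym; move: wN; rewrite inE.
  by rewrite cardsU1 !inE cadj_irr /= [_ :&: nbhd w]setIC; clear; lia.
have [w /andP[/andP[wN /eqP wk] /eqP w0]|noU2] :=
    pickP (fun w => (w \in nbhd u) && (#|nbhd w| == k) && (out w == 0)%N).
  have := nb_out w wN; rewrite w0 wk addn0 => cE.
  have wu := N_neq w wN.
  (* Here [c = k - 1], so the weight [1 / (k - 1)] makes the cross term vanish, and only [d < k + 1]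
     has to be shown. *)
  apply: (@lt_star_adjacent R G n3 d (k%:R - 1)^-1 u w) => //.
  - by rewrite eq_sym.
  - by rewrite inE in wN.
  - by rewrite subr_gt0.
  rewrite wk -cE natrD addrK; set c := _%:R.
  have c0 : 0 < c :> R by rewrite ltr0n; clear -cE k2; lia.
  have cn : c != 0 by rewrite gt_eqF.
  rewrite mulfV // subrr expr0n /=.
  have -> : 1 + c * c^-1 ^+ 2 + c * (1 + c^-1) ^+ 2 - d * (1 + c * c^-1 ^+ 2)
     = (1 + c^-1) * (c + 2 - d) by field.
  apply: mulr_gt0; first by rewrite subr_gt0.
  apply: mulr_gt0; first by rewrite addr_gt0 ?invr_gt0.
  rewrite subr_gt0.
  have n_d : #|G|%:R * d < #|G|%:R * (c + 2).
    have EW1 : (\sum_(w in W) #|nbhd w| <= #|W| * k)%N.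
      by rewrite -sum_nat_const; apply: leq_sum => x /W_neq[/maxv].
    rewrite d_avg -natrD -natrM ltr_nat sumE -cW; clear -EN1 EW1 cE kD; nia.
  by move: n_d; rewrite ltr_pM2l.
have out_pos w : w \in nbhd u -> #|nbhd w| = k -> (0 < out w)%N.
  by move=> wN wk; have := noU2 w; rewrite wN wk eqxx /= lt0n => ->.
have vN : v \in nbhd u by rewrite inE.
have EW1 : (\sum_(w in W) #|nbhd w| <= #|W| * k.-1)%N.
  by rewrite -sum_nat_const; apply: leq_sum => x /lowW.
(* The edges between [nbhd u] and [W] are counted from the side of [W], where they are part of the
   degrees. *)
have cross : (\sum_(w in nbhd u) out w <= \sum_(w in W) #|nbhd w|)%N.
  have oE w : out w = (\sum_(x in W) cadj w x)%N.
    rewrite /out -sum1_card big_mkcond [RHS]big_mkcond; apply: eq_bigr => x _.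
    by rewrite !inE; case: (cadj w x); case: (~~ _).
  rewrite (eq_bigr _ (fun w _ => oE w)) exchange_big /=; apply: leq_sum => x _.
  rewrite -sum1_card big_mkcond [leqRHS]big_mkcond; apply: leq_sum => w _.
  by rewrite !inE (cadj_sym w x); case: ifP => // _; case: cadj.
(* A neighbour of [u] of degree [k] has a neighbour in [W], so each degree over [nbhd u] is at most
   [k - 1] plus [out]. *)
have EN2 : (\sum_(w in nbhd u) #|nbhd w| <= D * k.-1 + \sum_(w in W) #|nbhd w|)%N.
  apply: leq_trans (leq_add (leqnn _) cross).
  rewrite -sum_nat_const -big_split; apply: leq_sum => w wN /=.
  have := maxv w (N_neq w wN); have := out_pos w wN.
  by case: (eqVneq #|nbhd w| k) => [-> /(_ erefl)|]; clear -k2; lia.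
have outW : (out v <= #|W|)%N by rewrite subset_leq_card ?subsetIr.
have vb := nb_out v vN; rewrite -/k in vb.
have v1 := out_pos v vN erefl.
apply: (@lt_star_adjacent R G n3 d (d - 1)^-1 u v) => //.
  by rewrite subr_gt0.
apply: (adjacent_star_bound (n := #|G|%:R) (b := (out v)%:R)) => //.
- by rewrite ler1n.
- by rewrite -/k -vb !natrD; ring.
- by rewrite ler_nat; clear -n3; lia.
- by rewrite kd.
- rewrite mulrBr d_avg -natrM.
  (* Each vertex of [W] falls short of [k] by at least 1, which pays for [out v]. *)
  have : (\sum_(w : G) #|nbhd w| + k + out v <= #|G| * k + D)%N by rewrite sumE -cW; clear -EN1 EW1 outW k2; nia.
  by rewrite -(ler_nat R) !natrD; lra.
have h : (2 * #|G| + k * \sum_(w : G) #|nbhd w| < #|G| * k * k.+1)%N.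
  rewrite sumE -cW; move: k2 EN1 EW1 EN2 {vb v1 cross outW out_pos noU2 noU1 lowW maxv kd kD kR DkR}.
  move: (\sum_(w in W) _)%N (\sum_(w in nbhd u) _)%N => EW EN.
  case: k => [|[|q]] //= _ EN1 EW1 EN2.
  (* With [k = q + 2], the product [k * EN] is split: [q] copies are bounded by [EN1] and two by
     [EN2], whose extra [2 * EW] joins [k * EW]. The coefficients of [D] and [#|W|] then match
     exactly, and the vertex [u] gives strictness. *)
  have a1 : (q * EN <= q * (D * q.+2))%N by rewrite leq_mul2l EN1 orbT.
  have a2 : ((q + 4) * EW <= (q + 4) * (#|W| * q.+1))%N by rewrite leq_mul2l EW1 orbT.
  clear -EN1 EW1 EN2 a1 a2; nia.
move: h; rewrite -(ltr_nat R) natrD !natrM -d_avg -natr1 => h.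
by move: h; rewrite !mulrA; lra.
Qed.

(** The exceptional complements are the empty graph, the balanced complete bipartite graph, and
    graphs with all edges at one vertex. *)
Lemma lt_or_special :
  [\/ lap_mu R G (#|G| - 2) < #|G|%:R - d,
      forall u v : G, ~~ cadj u v,
      exists2 S : {set G}, (forall u v : G, cadj u v = ((u \in S) != (v \in S)))
        & #|S| = #|~: S|
    | exists u : G, forall v w : G, v != u -> w != u -> ~~ cadj v w].
Proof.
have dn := avg_range.
have /card_gt0P[x0 _] : (0 < #|G|)%N by clear -n3; lia.
have [u _ maxu] := @arg_maxnP G x0 predT (fun w => #|nbhd w|) isT.
have [D_le_d|d_lt_D] := lerP #|nbhd u|%:R d.
  (* A maximal degree not above the average is the degree of every vertex. *)
  have reg (w : G) : #|nbhd w| = #|nbhd u|.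
    have sE : (\sum_(w : G) #|nbhd w| = \sum_(w : G) #|nbhd u|)%N.
      apply/eqP; rewrite eqn_leq; apply/andP; split; first by apply: leq_sum => x _; apply: maxu.
      by rewrite sum_nat_const -(ler_nat R) -d_avg natrM ler_pM2l.
    have := leqif_sum (fun x (_ : true) => leqif_eq (maxu x isT)).
    by move=> /leqifP; case: ifP => [/forallP/(_ w)/eqP|_]; rewrite ?sE ?ltnn.
  have dE : d = #|nbhd u|%:R.
    apply: (mulfI (x := #|G|%:R)); first by rewrite gt_eqF.
    by rewrite d_avg (eq_bigr _ (fun w _ => reg w)) sum_nat_const natrM.
  have [/eqP N0|[v vN]] := set_0Vmem (nbhd u).
    constructor 2 => v w; have /eqP := reg v.
    rewrite (eqP N0) cards0 cards_eq0 => /eqP/setP/(_ w); by rewrite !inE => ->.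
  case: (pickP (fun p : G * G => cadj p.1 p.2 && (nbhd p.1 :&: nbhd p.2 != set0))) => [[x y] /= /andP[axy C0]|tri].
    constructor 1; apply: (@lt_adjacent R G n3 d x y) => //.
    - by apply: contraTneq axy => ->; rewrite cadj_irr.
    - rewrite !reg leqnn andbT -(reg y).
      case/set0Pn: C0 => z; rewrite !inE => /andP[xz yz].
      rewrite (cardsD1 x) (cardsD1 z) !inE yz cadj_sym axy.
      by have -> : z != x by apply: contraTneq xz => ->; rewrite cadj_irr.
    - by rewrite dE reg lexx C0 orbT.
  case: (pickP (fun p : G * G => [&& p.1 != p.2, ~~ cadj p.1 p.2 & nbhd p.1 != nbhd p.2])) => [[x y] /= /and3P[xy nxy Nxy]|twin].
    by constructor 1; apply: (@lt_not_twins R G n3 d x y) => //; rewrite ?reg // dE.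
  have twins (x y : G) : ~~ cadj x y -> nbhd x = nbhd y.
    move=> nxy; have [->//|xy] := eqVneq x y.
    by have := twin (x, y); rewrite /= xy nxy /= => /negbFE/eqP.
  have tfree (x y z : G) : cadj x y -> cadj x z -> ~~ cadj y z.
    move=> xy xz; apply/negP => yz; have := tri (x, y); rewrite /= xy /=.
    by move/negbFE/eqP/setP/(_ z); rewrite !inE xz yz.
  (* Without triangles and with equal neighbourhoods at nonadjacent vertices, the sides are the
     neighbours and the nonneighbours of [u]. *)
  have cE (x y : G) : cadj x y = ((x \in nbhd u) != (y \in nbhd u)).
    have mem (z t : G) : ~~ cadj u z -> cadj z t = cadj u t.
      by move/twins/setP/(_ t); rewrite !inE.
    rewrite !inE; have [ux|ux] := boolP (cadj u x); last by rewrite (mem _ _ ux); case: (cadj u y).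
    have [uy|uy] := boolP (cadj u y); first exact/negbTE/(tfree u).
    by rewrite cadj_sym (mem _ _ uy) ux.
  constructor 3; exists (nbhd u) => //.
  (* The neighbourhood of [v] is the other side, so regularity makes the sides equal in size. *)
  rewrite -(reg v); congr #|pred_of_set _|; apply/setP => w.
  by move: vN; rewrite !inE (cE v w) !inE => ->; case: (cadj u w).
have /card_gt0P[x1 x1u] : (0 < #|[set~ u]|)%N by rewrite cardsC1; clear -n3; lia.
rewrite !inE in x1u.
have [v vu maxv] := @arg_maxnP G x1 (fun w => w != u) (fun w => #|nbhd w|) x1u.
have uv : u != v by rewrite eq_sym.
have vleu : (#|nbhd v| <= #|nbhd u|)%N by apply: maxu.
have [k1|k2] := leqP #|nbhd v| 1.
  case: (pickP (fun p : G * G => [&& p.1 != u, p.2 != u & cadj p.1 p.2])) => [[w z] /= /and3P[wu zu awz]|star].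
    have Nw : nbhd w = [set z].
      apply/esym/eqP; rewrite eqEcard sub1set inE awz cards1.
      by apply: leq_trans (maxv w wu) k1.
    have nuw : ~~ cadj u w.
      by have := in_set1 u z; rewrite -Nw inE cadj_sym => ->; rewrite eq_sym.
    have C0 : nbhd u :&: nbhd w = set0.
      apply/setP => x; rewrite Nw !inE; case: eqVneq => [->|]; rewrite ?andbF //.
      rewrite andbT; apply/negP => uz.
      have : [set u; w] \subset nbhd z.
        by apply/subsetP => t; rewrite !inE => /orP[] /eqP->; rewrite cadj_sym.
      move/subset_leq_card; rewrite cards2 eq_sym wu /= => h.
      by have := leq_trans h (leq_trans (maxv z zu) k1).
    constructor 1; apply: (@lt_star_nonadjacent R G n3 d u w) => //.
    - by rewrite eq_sym.
    - by rewrite subr_gt0.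
    - by rewrite Nw cards1.
    (* With [k = 1] and [c = 0] the condition comes down to [d < 2]; the degree sum is at most
       [#|nbhd u| + #|G| - 1]. *)
    rewrite C0 Nw cards0 cards1 expr0n add0r.
    rewrite !mulr_gt0 ?subr_gt0 ?addr_gt0 ?ltr01 //.
    rewrite -(ltr_pM2l n_gt0) d_avg -[1 + 1]/(2%:R) -natrM ltr_nat.
    have := sum_split1 u (fun w => #|nbhd w|).
    have h1 : (\sum_(w in nbhd u) #|nbhd w| <= #|nbhd u|)%N.
      rewrite -sum1_card; apply: leq_sum => x; rewrite inE => ux.
      apply: leq_trans k1; apply: maxv; by apply: contraTneq ux => ->; rewrite cadj_irr.
    have h2 : (\sum_(w in ~: (u |: nbhd u)) #|nbhd w| <= #|~: (u |: nbhd u)|)%N.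
      rewrite -sum1_card; apply: leq_sum => x; rewrite !inE negb_or => /andP[xu _].
      by apply: leq_trans k1; apply: maxv.
    have := cardsC (u |: nbhd u); rewrite cardsU1 inE cadj_irr /= => h3 ->.
    by have := card_nbhd_lt u; clear -h1 h2 h3; lia.
  constructor 4; exists u => x y xu yu; have := star (x, y).
  by rewrite /= xu yu /= => ->.
have [kd|dk] := lerP #|nbhd v|%:R d.
  by constructor 1; apply: (@lt_heavy u v) => //; rewrite kd.
constructor 1; have [auv|nuv] := boolP (cadj u v).
  by apply: (@lt_adjacent R G n3 d u v) => //; rewrite ?k2 ?dk.
by apply: (@lt_nonadjacent R G n3 d u v).
Qed.
End Cases.

(** * Extremal graphs *)

Lemma star_leaf (G : sgraph) (u : G) :
  (forall v w : G, v != u -> w != u -> ~~ cadj v w) ->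
  forall v, v \in nbhd u -> nbhd v = [set u].
Proof.
move=> star v; rewrite inE => uv; apply/setP => w; rewrite !inE.
have vu : v != u by apply: contraTneq uv => ->; rewrite cadj_irr.
by have [->|wu] := eqVneq w u; [rewrite cadj_sym | apply/negbTE/star].
Qed.

Lemma sum_nbhd_star (G : sgraph) (u : G) :
  (forall v w : G, v != u -> w != u -> ~~ cadj v w) ->
  (\sum_(v : G) #|nbhd v| = 2 * #|nbhd u|)%N.
Proof.
move=> star; rewrite (sum_split1 u) [X in (_ + X)%N]big1 => [|v]; last first.
  rewrite !inE negb_or => /andP[vu nuv]; apply/eqP; rewrite cards_eq0.
  apply/eqP/setP => w; rewrite !inE.
  by have [->|wu] := eqVneq w u; [rewrite cadj_sym (negPf nuv) | apply/negbTE/star].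
rewrite (eq_bigr (fun=> 1%N)) => [|v vN]; last by rewrite (star_leaf star vN) cards1.
by rewrite sum1_card addn0 mul2n addnn.
Qed.

Section Extremal.
Variables (R : rcfType) (G : sgraph).
Hypothesis n3 : (2 < #|G|)%N.
Implicit Types x : G -> R.

Lemma energy_adjE x : energy (@adj G) x =
  2 * (#|G|%:R * \sum_a x a ^+ 2 - (\sum_a x a) ^+ 2) - energy (@cadj G) x.
Proof. by rewrite -energy_complement addrK. Qed.

Lemma energy_cadjE x : energy (@cadj G) x =
  2 * (\sum_a #|nbhd a|%:R * x a ^+ 2 - \sum_a \sum_b (cadj a b)%:R * (x a * x b)).
Proof. exact/energyE/cadj_sym. Qed.

(** The weak bound as a limit of the strict criteria, which hold only for [d'] below [d]. *)
Lemma lap_mu_le (d : R) : 0 < d ->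
  (forall d', 0 <= d' < d -> lap_mu R G (#|G| - 2) < #|G|%:R - d') ->
  lap_mu R G (#|G| - 2) <= #|G|%:R - d.
Proof.
move=> d0 hd; rewrite leNgt; apply/negP => lt1.
pose d' := Num.max 0 (#|G|%:R - lap_mu R G (#|G| - 2)).
have : 0 <= d' < d.
  by rewrite /d' le_max lexx gt_max d0 ltrBlDr -ltrBlDl.
by move=> /hd; rewrite ltrBrDr -ltrBrDl ltNge /d' le_max lexx orbT.
Qed.

Lemma lap_mu_complete : (forall u v : G, ~~ cadj u v) ->
  lap_mu R G (#|G| - 2) = #|G|%:R.
Proof.
move=> noc.
have e0 x : energy (@cadj G) x = 0.
  rewrite /energy; apply: big1 => a _; apply: big1 => b _.
  by rewrite (negPf (noc a b)) mul0r.
apply/eqP; rewrite eq_le; apply/andP; split.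
  rewrite leNgt; apply/negP => lt1.
  (* The eigenvalue itself, assumed larger than [#|G|], is taken as the strict bound. *)
  suff : lap_mu R G (#|G| - 2) < lap_mu R G (#|G| - 2) by rewrite ltxx.
  apply: lap_mu_lt => // x x0; rewrite energy_adjE e0 subr0 -mulrA ltr_pM2l ?ltr0n //.
  apply: (@le_lt_trans _ _ (#|G|%:R * \sum_a x a ^+ 2)).
    by rewrite gerBl sqr_ge0.
  by rewrite ltr_pM2r.
apply: (@lap_mu_ge R G (fun=> 1) (fun=> 1)) => // x.
rewrite -mulr_suml mulr1 => s0 _; rewrite energy_adjE e0 s0 expr0n !subr0 mulrA.
exact: lexx.
Qed.

(** Two vertices of [S] bound the eigenvalue from above. Conversely, if [x] sums to 0 on [S] and on
    its complement, the adjacency part of the form of [H] vanishes and leaves [#|S|] times the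
    squared norm. *)
Lemma lap_mu_complete_bipartite (S : {set G}) :
  (forall u v : G, cadj u v = ((u \in S) != (v \in S))) -> #|S| = #|~: S| ->
  lap_mu R G (#|G| - 2) = #|G|%:R - #|S|%:R.
Proof.
move=> cE cS.
have nS : #|G| = (#|S| + #|S|)%N by rewrite -(cardsC S) -cS.
have N (a : G) : #|nbhd a| = #|S|.
  have [aS|aS] := boolP (a \in S).
    by rewrite cS; congr #|pred_of_set _|; apply/setP => b; rewrite !inE cE aS.
  by congr #|pred_of_set _|; apply/setP => b; rewrite !inE cE (negPf aS); case: (b \in S).
apply/eqP; rewrite eq_le; apply/andP; split.
  have S2 : (1 < #|S|)%N by clear -nS n3; lia.
  have /card_gt1P[u [v [uS vS uv]]] := S2.
  apply: lap_mu_le => [|d' /andP[d0 dS]]; first by rewrite ltr0n; clear -S2; lia.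
  apply: (@lt_nonadjacent R G n3 d' u v) => //; rewrite ?cE ?uS ?vS ?N //.
  by rewrite d0 (lt_le_trans dS) // ler_nat nS leq_addr.
apply: (@lap_mu_ge R G (fun a => (a \in S)%:R) (fun a => (a \notin S)%:R)) => // x sS sC.
have sE (P : pred G) : \sum_a x a * (P a)%:R = \sum_(a | P a) x a.
  by rewrite [RHS]big_mkcond; apply: eq_bigr => a _; case: (P a); rewrite ?mulr1 ?mulr0.
rewrite (sE (fun a => a \in S)) in sS; rewrite (sE (fun a => a \notin S)) in sC.
have s0 : \sum_a x a = 0 by rewrite (bigID (mem S)) /= sS sC addr0.
rewrite energy_adjE energy_cadjE s0 expr0n subr0.
rewrite [X in _ <= _ - 2 * (_ - X)]big1 => [|a _]; last first.
  have [aS|aS] := boolP (a \in S).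
    rewrite (eq_bigr (fun b => x a * (x b * (b \notin S)%:R))) => [|b _].
      by rewrite -mulr_sumr (sE (fun b => b \notin S)) sC mulr0.
    by rewrite cE aS; case: (b \in S); rewrite /= ?mul0r ?mulr0 ?mul1r ?mulr1.
  rewrite (eq_bigr (fun b => x a * (x b * (b \in S)%:R))) => [|b _].
    by rewrite -mulr_sumr (sE (fun b => b \in S)) sS mulr0.
  by rewrite cE (negPf aS); case: (b \in S); rewrite /= ?mul0r ?mulr0 ?mul1r ?mulr1.
under [X in _ <= _ - 2 * (X - _)]eq_bigr => a _ do rewrite N.
by rewrite -mulr_sumr subr0 nS natrD; lra.
Qed.

(** Two leaves give the upper bound. For the lower one, [x] vanishes at [u] and sums to 0: no edge
    term survives, and all remaining degrees are at most 1. *)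
Lemma lap_mu_star (u : G) :
  (forall v w : G, v != u -> w != u -> ~~ cadj v w) -> (1 < #|nbhd u|)%N ->
  lap_mu R G (#|G| - 2) = #|G|%:R - 1.
Proof.
move=> star L2.
have leaf := star_leaf star.
apply/eqP; rewrite eq_le; apply/andP; split.
  have /card_gt1P[v [w [vL wL vw]]] := L2.
  apply: lap_mu_le => // d' hd'.
  apply: (@lt_two_leaves R G n3 d' u v w) => //; [|exact: leaf|exact: leaf].
  by apply: contraTneq vL => ->; rewrite inE cadj_irr.
apply: (@lap_mu_ge R G (fun a => (a == u)%:R) (fun=> 1)) => // x.
have -> : \sum_a x a * (a == u)%:R = x u.
  rewrite (bigD1 u) //= eqxx mulr1 big1 ?addr0 // => a /negPf ->.
  by rewrite mulr0.
rewrite -mulr_suml mulr1 => xu s0.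
rewrite energy_adjE energy_cadjE s0 expr0n subr0.
rewrite [X in _ <= _ - 2 * (_ - X)]big1 => [|a _]; last first.
  apply: big1 => b _; have [->|au] := eqVneq a u; first by rewrite xu mul0r mulr0.
  have [->|bu] := eqVneq b u; first by rewrite xu !mulr0.
  by rewrite (negPf (star a b au bu)) mul0r.
rewrite subr0.
have : \sum_a #|nbhd a|%:R * x a ^+ 2 <= \sum_a x a ^+ 2.
  apply: ler_sum => a _; have [->|au] := eqVneq a u; first by rewrite xu expr0n mulr0.
  rewrite ler_piMl ?sqr_ge0 // lern1.
  have : nbhd a \subset [set u].
    by apply/subsetP => w; rewrite !inE; apply: contraLR => wu; apply: star.
  by move/subset_leq_card; rewrite cards1.
by lra.
Qed.
End Extremal.

(** * Isomorphisms from vertex labellings *)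

Section Labels.
Variable C : eqType.

(** Each [t] goes to the element of the same rank in the fibre with the same label. *)
Lemma fiber_bijection (T X : finType) (c : T -> C) (c' : X -> C) :
  #|T| = #|X| -> (forall l, #|[set t | c t == l]| = #|[set x | c' x == l]|) ->
  exists2 f : T -> X, bijective f & forall t, c' (f t) = c t.
Proof.
move=> cTX cF.
have lt_ind t : (index t (enum [set t' | c t' == c t]) < #|[set x | c' x == c t]|)%N.
  by rewrite -cF cardE index_mem mem_enum inE.
pose f t : X := enum_val (Ordinal (lt_ind t)).
have fc t : c' (f t) = c t by have := enum_valP (Ordinal (lt_ind t)); rewrite inE => /eqP.
exists f => //; apply: inj_card_bij; last by rewrite cTX.
move=> t t' ft; have ct : c t = c t' by rewrite -!fc ft.
have x0 := f t; move/eqP: ft; rewrite /f !(enum_val_nth x0) /= ct.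
have mt : t \in enum [set t0 | c t0 == c t'] by rewrite mem_enum inE ct.
have mt' : t' \in enum [set t0 | c t0 == c t'] by rewrite mem_enum inE.
rewrite nth_uniq ?enum_uniq -?cardE -?cF ?[X in (_ < X)%N]cardE ?index_mem //.
by move=> /eqP/(congr1 (nth t (enum [set t0 | c t0 == c t']))); rewrite !nth_index.
Qed.

(** Such a graph is determined up to isomorphism by [phi] and the sizes of the label classes. *)
Definition labelled (phi : rel C) (G : sgraph) (c : G -> C) :=
  forall u v : G, adj u v = (u != v) && phi (c u) (c v).

Lemma iso_of_labels (phi : rel C) (G H : sgraph) (c : G -> C) (c' : H -> C) :
  labelled phi c -> labelled phi c' -> #|G| = #|H| ->
  (forall l, #|[set t | c t == l]| = #|[set x | c' x == l]|) -> iso_graph G H.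
Proof.
move=> lc lc' cGH cF; have [f bf fc] := fiber_bijection cGH cF.
by exists f => // u v; rewrite lc lc' !fc (bij_eq bf).
Qed.

Lemma labels_of_iso (phi : rel C) (G H : sgraph) (c' : H -> C) :
  labelled phi c' -> iso_graph G H ->
  exists2 c : G -> C, labelled phi c &
    forall l, #|[set t | c t == l]| = #|[set x | c' x == l]|.
Proof.
move=> lc' [f bf fa]; exists (c' \o f) => [u v|l]; first by rewrite -fa lc' (bij_eq bf).
rewrite -(card_imset _ (bij_inj bf)); congr #|pred_of_set _|; apply/setP => x.
have [g fK gK] := bf.
apply/imsetP/idP => [[t]|]; rewrite !inE; first by move=> h ->.
by move=> h; exists (g x); rewrite ?gK // inE /= gK.
Qed.
End Labels.

Lemma iso_complete (G : sgraph) : (forall u v : G, ~~ cadj u v) -> iso_graph G (complete #|G|).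
Proof.
move=> noc; exists (@enum_rank G); first exact: enum_rank_bij.
move=> u v; rewrite /= (can_eq (@enum_rankK G)).
by have := noc u v; rewrite /cadj; case: eqVneq => [->|_] /=; rewrite ?adj_irr // negbK.
Qed.

Lemma complete_iso (G : sgraph) p : iso_graph G (complete p) -> forall u v : G, ~~ cadj u v.
Proof.
case=> f bf fa u v; rewrite /cadj -fa /= (bij_eq bf).
by case: (u != v).
Qed.

Definition clique_label p (x : disj_union (complete p) (complete p)) : bool :=
  if x is inl _ then true else false.

Lemma clique_labelled p : labelled (fun l l' => l == l') (@clique_label p).
Proof. by move=> [i|i] [j|j] /=; rewrite ?andbT ?andbF. Qed.

Lemma card_clique_label p l : #|[set x | @clique_label p x == l]| = p.
Proof.
case: l.
  rewrite (_ : [set x | _] = [set inl i | i : 'I_p]); last first.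
    apply/setP => -[i|i]; rewrite !inE; first by rewrite imset_f.
    by apply/esym/imsetP => -[].
  by rewrite card_imset ?card_ord // => i j [].
rewrite (_ : [set x | _] = [set inr i | i : 'I_p]); last first.
  apply/setP => -[i|i]; rewrite !inE; last by rewrite imset_f.
  by apply/esym/imsetP => -[].
by rewrite card_imset ?card_ord // => i j [].
Qed.

Lemma iso_two_cliques (G : sgraph) (S : {set G}) :
  (forall u v : G, cadj u v = ((u \in S) != (v \in S))) -> #|S| = #|~: S| ->
  iso_graph G (disj_union (complete #|S|) (complete #|S|)).
Proof.
move=> cE cS.
apply: (iso_of_labels (c := fun u => u \in S) _ (@clique_labelled _)) => [u v||l].
- have := cE u v; rewrite /cadj; case: eqVneq => [->|_] /=; first by rewrite adj_irr.
  by move/negbRL => ->; rewrite negbK.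
- by rewrite card_sum !card_ord {2}cS cardsC.
rewrite card_clique_label; case: l; first by congr #|pred_of_set _|; apply/setP => u; rewrite inE eqb_id.
by rewrite cS; congr #|pred_of_set _|; apply/setP => u; rewrite !inE eqbF_neg.
Qed.

Lemma two_cliques_iso (G : sgraph) p : iso_graph G (disj_union (complete p) (complete p)) ->
  exists2 S : {set G}, (forall u v : G, cadj u v = ((u \in S) != (v \in S)))
    & #|S| = #|~: S|.
Proof.
case/(labels_of_iso (@clique_labelled p)) => c lc cc; exists [set u | c u].
  move=> u v; rewrite /cadj lc !inE; case: eqVneq => [->|_] /=; first by rewrite eqxx.
  by [].
have := cc true; have := cc false; rewrite !card_clique_label => cf ct.
rewrite (_ : ~: _ = [set u | c u == false]).
  by rewrite cf -ct; congr #|pred_of_set _|; apply/setP => u; rewrite !inE eqb_id.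
by apply/setP => u; rewrite !inE eqbF_neg.
Qed.

(* [None] labels the centre of the complementary star, [Some true] its leaves,
   [Some false] its isolated vertices. *)
Definition costar_rel : rel (option bool) := fun l l' =>
  ~~ ((l == None) && (l' == Some true) || (l == Some true) && (l' == None)).

(** The complement of a star with [s] leaves together with [r] isolated vertices. *)
Definition costar s r := join (disj_union (complete 1) (complete s)) (complete r).

Definition costar_label s r (x : costar s r) : option bool :=
  match x with inl (inl _) => None | inl (inr _) => Some true | inr _ => Some false end.

Lemma costar_labelled s r : labelled costar_rel (@costar_label s r).
Proof.
move=> [[i|i]|i] [[j|j]|j] //=; rewrite /costar_rel /= ?andbT ?andbF //.
Qed.

Lemma card_costar_label s r l : #|[set x | @costar_label s r x == l]| =
  match l with None => 1 | Some true => s | Some false => r end.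
Proof.
case: l => [[]|].
- rewrite (_ : [set x | _] = [set inl (inr i) | i : 'I_s]); last first.
    apply/setP => -[[i|i]|i]; rewrite !inE; last 1 first.
    + by apply/esym/imsetP => -[].
    + by apply/esym/imsetP => -[].
    by apply/esym/imsetP; exists i.
  by rewrite card_imset ?card_ord // => i j [].
- rewrite (_ : [set x | _] = [set inr i | i : 'I_r]); last first.
    apply/setP => -[i|i]; rewrite !inE; last by rewrite imset_f.
    by case: i => i; apply/esym/imsetP => -[].
  by rewrite card_imset ?card_ord // => i j [].
rewrite (_ : [set x | _] = [set inl (inl i) | i : 'I_1]); last first.
  apply/setP => -[[i|i]|i]; rewrite !inE.
  - by apply/esym/imsetP; exists i.
  - by apply/esym/imsetP => -[].
  by apply/esym/imsetP => -[].
by rewrite card_imset ?card_ord // => i j [].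
Qed.

Lemma iso_costar (G : sgraph) (u : G) :
  (forall v w : G, v != u -> w != u -> ~~ cadj v w) ->
  iso_graph G (costar #|nbhd u| (#|G| - #|nbhd u| - 1)).
Proof.
move=> star; pose c w := if w == u then None else Some (cadj u w).
have nu := card_nbhd_lt u.
have cN : [set w | c w == Some true] = nbhd u.
  by apply/setP => w; rewrite !inE /c; have [->|wu] := eqVneq w u; rewrite ?cadj_irr //; case: cadj.
have cU : [set w | c w == None] = [set u].
  by apply/setP => w; rewrite !inE /c; case: (w == u).
have cF : [set w | c w == Some false] = ~: (u |: nbhd u).
  by apply/setP => w; rewrite !inE /c; case: (w == u) => //=; case: cadj.
have ccF := cardsC (u |: nbhd u); rewrite cardsU1 inE cadj_irr /= in ccF.
apply: (iso_of_labels (c := c) _ (@costar_labelled _ _)) => [v w||l].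
- have -> : adj v w = (v != w) && ~~ cadj v w.
    by rewrite /cadj; case: eqVneq => [->|_] /=; rewrite ?adj_irr ?negbK.
  congr (_ && ~~ _); rewrite /c; have [->|vu] := eqVneq v u; have [->|wu] := eqVneq w u.
  + by rewrite cadj_irr.
  + by rewrite /= orbF; case: cadj.
  + by rewrite cadj_sym /= andbT; case: cadj.
  by rewrite (negPf (star _ _ vu wu)) !andbF.
- by rewrite !card_sum !card_ord; clear -nu; lia.
rewrite card_costar_label; case: l => [[]|]; rewrite ?cN ?cU ?cF ?cards1 //.
by rewrite -ccF; clear; lia.
Qed.

Lemma costar_iso (G : sgraph) s r : iso_graph G (costar s r) ->
  exists2 u : G, forall v w : G, v != u -> w != u -> ~~ cadj v w & #|nbhd u| = s.
Proof.
case/(labels_of_iso (@costar_labelled s r)) => c lc cc.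
have := cc None; rewrite card_costar_label => /eqP/cards1P[u /setP cu].
have cN w : (c w == None) = (w == u) by have := cu w; rewrite !inE.
have cE v w : cadj v w = (v != w) && ~~ costar_rel (c v) (c w).
  by rewrite /cadj lc; case: (v != w).
exists u => [v w vu wu|].
  by rewrite cE /costar_rel !cN (negPf vu) (negPf wu) !andbF.
rewrite -[RHS](card_costar_label s r (Some true)) -cc.
congr #|pred_of_set _|; apply/setP => w; rewrite !inE cE /costar_rel negbK !cN eqxx /=.
have /eqP-> : c u == None by rewrite cN.
rewrite /= orbF; case: eqVneq => [<-|//] /=.
by have := cN u; rewrite eqxx => /eqP ->.
Qed.

(** * Degree sums and attainment of the bound *)

Lemma handshake (G : sgraph) : (2 * #|edges G| = \sum_(u : G) degree u)%N.
Proof.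
pose D := [set p : G * G | adj p.1 p.2].
have -> : (\sum_(u : G) degree u)%N = #|D|.
  rewrite -sum1_card (eq_bigl (fun p => adj p.1 p.2)) => [|p]; last by rewrite inE.
  rewrite (eq_bigr (fun u => \sum_(v | adj u v) 1)%N) => [|u _]; last first.
    by rewrite /degree -sum1_card; apply: eq_bigl => v; rewrite inE.
  by rewrite pair_big_dep.
pose e (p : G * G) := [set p.1; p.2].
have -> : edges G = e @: D by apply/setP => E; apply/imsetP/imsetP => -[p]; rewrite ?inE => h ->; exists p; rewrite ?inE.
rewrite -[RHS]sum1_card (partition_big_imset e) /= mulnC -sum_nat_const.
apply: eq_bigr => E /imsetP[[a b]]; rewrite inE /= => ab ->.
have nab : a != b by apply: contraTneq ab => ->; rewrite adj_irr.
rewrite sum1dep_card (_ : [set p | _] = [set (a, b); (b, a)]).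
  by rewrite cards2 xpair_eqE negb_and nab.
apply/setP => -[x y]; rewrite !inE /e /= !xpair_eqE.
apply/andP/orP => [[xy /eqP/setP exy]|].
  have nxy : x != y by apply: contraTneq xy => ->; rewrite adj_irr.
  have := exy x; have := exy y; rewrite !inE !eqxx orbT /=.
  move=> /esym/orP[]/eqP ey /esym/orP[]/eqP ex; subst x y.
  - by rewrite eqxx in nxy.
  - by right; rewrite !eqxx.
  - by left; rewrite !eqxx.
  by rewrite eqxx in nxy.
by case=> /andP[/eqP-> /eqP->]; rewrite ?[adj b a]adj_sym ab; split=> //; rewrite setUC.
Qed.

Lemma degree_complement (G : sgraph) (u : G) : (degree u + #|nbhd u| = #|G|.-1)%N.
Proof.
rewrite -(cardsC1 u) /degree -(cardsID [set y | adj u y] [set~ u]); congr (_ + _)%N.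
  congr #|pred_of_set _|; apply/setP => w; rewrite !inE.
  by case: eqVneq => [->|]; rewrite ?adj_irr.
by congr #|pred_of_set _|; apply/setP => w; rewrite !inE /cadj eq_sym andbC.
Qed.

Section Average.
Variables (R : rcfType) (G : sgraph) (d : R).
Hypothesis n3 : (2 < #|G|)%N.
Hypothesis d_avg : #|G|%:R * d = (\sum_(u : G) #|nbhd u|)%:R.

Let n_neq0 : #|G|%:R != 0 :> R. Proof. by rewrite pnatr_eq0; clear -n3; lia. Qed.

(** The degrees of a vertex in [G] and in its complement add up to [#|G| - 1]; summing over all
    vertices gives the bound of the theorem. *)
Lemma avg_edges : #|G|%:R - d = (2 * #|edges G|)%:R / #|G|%:R + 1.
Proof.
have h : (2 * #|edges G| + \sum_(u : G) #|nbhd u| = #|G| * #|G|.-1)%N.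
  rewrite handshake -big_split /= (eq_bigr _ (fun u _ => degree_complement u)).
  by rewrite sum_nat_const.
apply: (mulfI n_neq0); rewrite mulrBr d_avg mulrDr mulr1 mulrCA mulfV // mulr1.
have : #|G|%:R = #|G|.-1%:R + 1 :> R by rewrite natr1 prednK //; clear -n3; lia.
move: h => /(congr1 (fun k => k%:R : R)); rewrite natrD natrM => h hn.
by rewrite {2}hn; lra.
Qed.

Lemma complete_attains : (forall u v : G, ~~ cadj u v) ->
  lap_mu R G (#|G| - 2) = #|G|%:R - d.
Proof.
move=> noc; rewrite lap_mu_complete //.
have -> : d = 0; last by rewrite subr0.
apply: (mulfI n_neq0); rewrite d_avg mulr0 big1 // => u _; apply/eqP.
by rewrite cards_eq0; apply/eqP/setP => v; rewrite !inE (negPf (noc u v)).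
Qed.

Lemma two_cliques_attains (S : {set G}) :
  (forall u v : G, cadj u v = ((u \in S) != (v \in S))) -> #|S| = #|~: S| ->
  lap_mu R G (#|G| - 2) = #|G|%:R - d.
Proof.
move=> cE cS; rewrite (lap_mu_complete_bipartite _ _ cE) //.
congr (_ - _); apply: (mulfI n_neq0); rewrite d_avg -natrM -sum_nat_const.
congr (_%:R); apply: eq_bigr => u _.
have [uS|uS] := boolP (u \in S).
  by rewrite cS; congr #|pred_of_set _|; apply/setP => b; rewrite !inE cE uS.
by congr #|pred_of_set _|; apply/setP => b; rewrite !inE cE (negPf uS); case: (b \in S).
Qed.

(** A star with [s] leaves has degree sum [2 * s], so [2 * s = #|G|] means [d = 1]. *)
Lemma costar_attains (u : G) :
  (forall v w : G, v != u -> w != u -> ~~ cadj v w) -> (2 * #|nbhd u| = #|G|)%N ->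
  lap_mu R G (#|G| - 2) = #|G|%:R - d.
Proof.
move=> star hu; rewrite (lap_mu_star _ _ star) //; last by clear -hu n3; lia.
by congr (_ - _); apply: (mulfI n_neq0); rewrite d_avg mulr1 (sum_nbhd_star star) hu.
Qed.
End Average.

Theorem theorem3p6 (R : rcfType) (G : sgraph) (n m : nat)
  (hn : #|G| = n) (hn3 : (3 <= n)%N) (hm : #|edges G| = m)
  (hG : forall r : nat,
     (0 <= r <= uphalf n - 2)%N \/ r = (n - 2)%N ->
     ~ iso_graph G
         (join (disj_union (complete 1) (complete (n - r - 1))) (complete r))) :
  lap_mu R G (n - 2) <= (2 * m)%:R / n%:R + 1
  /\ (lap_mu R G (n - 2) = (2 * m)%:R / n%:R + 1 <->
      iso_graph G (complete n)
      \/ (~~ odd n /\ iso_graph G (disj_union (complete n./2) (complete n./2)))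
      \/ (~~ odd n /\
          iso_graph G
            (join (disj_union (complete 1) (complete n./2))
                  (complete (n./2 - 1))))).
Proof.
subst n m.
pose d : R := (\sum_(u : G) #|nbhd u|)%:R / #|G|%:R.
have d_avg : #|G|%:R * d = (\sum_(u : G) #|nbhd u|)%:R.
  by rewrite /d mulrCA mulfV ?mulr1 // pnatr_eq0; clear -hn3; lia.
rewrite -(avg_edges hn3 d_avg).
have attains : (iso_graph G (complete #|G|)
      \/ (~~ odd #|G| /\ iso_graph G (disj_union (complete #|G|./2) (complete #|G|./2)))
      \/ (~~ odd #|G| /\
          iso_graph G (join (disj_union (complete 1) (complete #|G|./2))
                            (complete (#|G|./2 - 1))))) ->
    lap_mu R G (#|G| - 2) = #|G|%:R - d.
  case=> [|[]].
  - by move/complete_iso; apply: complete_attains.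
  - by case=> _ /two_cliques_iso[S cE cS]; apply: two_cliques_attains cE cS.
  case=> ev /costar_iso[u star su]; apply: (costar_attains hn3 d_avg star).
  by rewrite su mul2n -[RHS]odd_double_half (negPf ev).
(* Since the three graphs attain the bound, this alternative yields both the inequality and the
   converse. *)
suff : lap_mu R G (#|G| - 2) < #|G|%:R - d \/
   (iso_graph G (complete #|G|)
      \/ (~~ odd #|G| /\ iso_graph G (disj_union (complete #|G|./2) (complete #|G|./2)))
      \/ (~~ odd #|G| /\
          iso_graph G (join (disj_union (complete 1) (complete #|G|./2))
                            (complete (#|G|./2 - 1))))).
  case=> [lt1|iso]; last by rewrite attains.
  split; first exact: ltW.
  by split=> [e|/attains //]; rewrite e ltxx in lt1.
case: (lt_or_special hn3 d_avg) => [lt1|noc|[S cE cS]|[u star]]; first by left.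
- by right; left; apply: iso_complete.
- right; right; left.
  have nS : #|G| = #|S|.*2 by rewrite -addnn -(cardsC S) -cS.
  by rewrite nS odd_double doubleK; split=> //; apply: iso_two_cliques.
have iso := iso_costar star; rewrite /costar in iso.
have su := card_nbhd_lt u.
have [s0|s0] := posnP #|nbhd u|.
  right; left; apply: iso_complete => v w; apply/negP => vw.
  have h x : ~~ cadj u x.
    by apply/negP => ux; move/eqP: s0; rewrite cards_eq0 => /eqP/setP/(_ x); rewrite !inE ux.
  have vu : v != u by apply: contraTneq vw => ->; apply: h.
  have wu : w != u by apply: contraTneq vw => ->; rewrite cadj_sym; apply: h.
  by move: (star v w vu wu); rewrite vw.
have er : (#|G| - (#|G| - #|nbhd u| - 1) - 1)%N = #|nbhd u| by clear -su; lia.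
(* Let [s] be the number of leaves, so [r = n - s - 1]. Excluding [r = n - 2] rules out [s = 1], and
   excluding [r] up to [uphalf n - 2] gives [2 * s <= n]. *)
have := hG (#|G| - #|nbhd u| - 1)%N; rewrite er => nr.
have r1 : (#|G| - #|nbhd u| - 1 <> #|G| - 2)%N by move=> e; apply: (nr _ iso); right.
have r2 : ~ (0 <= #|G| - #|nbhd u| - 1 <= uphalf #|G| - 2)%N.
  by move=> e; apply: (nr _ iso); left.
have hh := odd_double_half #|G|; have hu := uphalf_half #|G|.
have s2 : (1 < #|nbhd u|)%N by clear -r1 su s0 hn3; lia.
have le_s : (2 * #|nbhd u| <= #|G|)%N.
  by clear -r2 su hh hu hn3; move: r2 hh hu; case: odd => /=; lia.
(* As [d = 2 * s / n], a strict inequality here means [d < 1], where two leaves suffice; equality is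
   the last extremal graph. *)
have [lt_s|ge_s] := ltnP (2 * #|nbhd u|) #|G|.
  left; have /card_gt1P[v [w [vL wL vw]]] := s2.
  apply: (@lt_two_leaves R G hn3 d u v w) => //; try exact: star_leaf.
  - rewrite -(pmulr_rge0 d (x := #|G|%:R)) ?ltr0n; last by clear -hn3; lia.
    rewrite d_avg ler0n /= -(ltr_pM2l (x := #|G|%:R)) ?ltr0n; last by clear -hn3; lia.
    by rewrite d_avg mulr1 ltr_nat (sum_nbhd_star star).
  by apply: contraTneq vL => ->; rewrite inE cadj_irr.
right; right; right.
have nE : #|G| = #|nbhd u|.*2 by clear -le_s ge_s; lia.
have er' : (#|G| - #|nbhd u| - 1 = #|nbhd u| - 1)%N by clear -nE; lia.
rewrite er' in iso; split; first by rewrite nE odd_double.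
by have -> : #|G|./2 = #|nbhd u| by rewrite nE doubleK.
Qed.
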